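(* Let $0<q\leq\infty$, $\alpha>-1/q$ and $\varepsilon>0$. Then there is a constant $C$ depending only on $q$, $\alpha$ and $\varepsilon$ such that the following holds. Let $\{\varphi_n\}$ be an orthonormal system in $L_2(0,1)$ with $M:=\sup_n\|\varphi_n\|_{L_\infty(0,1)}<\infty$, let $\{c_n\}$ be a sequence of complex numbers, and let $f=\sum_{n}c_n\varphi_n$. Then $$\left(\int_0^1\left[(1+|\log t|)^{\alpha}\left(\int_0^t\left(f^*(u)\right)^2du\right)^{1/2}\right]^q t^{-1}\,dt\right)^{1/q}\leq C\,\min\left(M,(1+\log M)^{|\alpha|+\varepsilon+1/q}\right)\left(\sum_{k=1}^{\infty}\left[(1+|\log k|)^{\alpha}\left(\sum_{i=k}^{\infty}\left(c_i^*\right)^2\right)^{1/2}\right]^q k^{-1}\right)^{1/q}.$$ When $q=\infty$, the outer integral and outer sum are replaced by suprema, that is, by $\sup_{0<t<1}(1+|\log t|)^{\alpha}\left(\int_0^t (f^*(u))^2du\right)^{1/2}$ and $\sup_{k\ge1}(1+|\log k|)^{\alpha}\left(\sum_{i=k}^\infty (c_i^* )^2\right)^{1/2}$ respectively. In particular, if the expression on the right-hand side is finite, then the series $\sum_{n}c_n\varphi_n$ converges in the (quasi-)norm determined by the expression on the left-hand side.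
   Context: Functions are (equivalence classes of) complex-valued measurable functions on $[0,1]$ with Lebesgue measure. The system $\{\varphi_n\}$ is indexed by $n\in\mathbb{N}$ or $n\in\mathbb{Z}$, and sequences $\{c_n\}$ have the same index set. $f^*$ is the non-increasing rearrangement of $|f|$, and $\{c_k^*\}_{k\in\mathbb{N}}$ is the non-increasing rearrangement of the sequence $\{|c_n|\}$. The map $\{c_n\}\mapsto f=\sum_n c_n\varphi_n$ is the inverse of the Fourier series map and is bounded from $\ell_2$ to $L_2(0,1)$. Orthonormality implies $M\geq1$. The convention $1/\infty=0$ is used.
   Formalization: Convergence of the series in the left-hand (quasi-)norm is asserted only for q<∞, since it fails for q=∞; for q=∞ the theorem instead gives convergence in L_2 to an f whose left-hand expression is finite. *)

(* Defs.v *)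
From HB Require Import structures.
From mathcomp Require Import all_boot all_order all_algebra.
From mathcomp Require Import complex.
From mathcomp Require Import all_classical all_reals all_analysis.

Set Implicit Arguments.
Unset Strict Implicit.
Unset Printing Implicit Defensive.

Import Order.TTheory GRing.Theory Num.Theory.
Import numFieldNormedType.Exports.
Import ComplexField.Normc.

Local Open Scope classical_set_scope.
Local Open Scope ring_scope.

Variant index_kind := Naturals | Integers.

Definition index_type (k : index_kind) : countType :=
  match k with Naturals => nat | Integers => int end.

(* The indices 0 <= i < n for the naturals (m is then irrelevant), and
   - m <= i < n for the integers: the limit m, n --> +oo is the usual
   convergence of one-sided, resp. two-sided, series. *)
Definition window (k : index_kind) (m n : nat) : seq (index_type k) :=
  match k return seq (index_type k) with
  | Naturals => iota 0 n
  | Integers => [seq i%:Z - m%:Z | i <- iota 0 (m + n)]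
  end.

Section functions.
Context {R : realType}.
Implicit Types (f g : R -> R[i]) (p q : \bar R) (alpha s t u : R).

Definition cmeasurable f :=
  measurable_fun (`[0, 1] : set R) (fun x => complex.Re (f x)) /\
  measurable_fun (`[0, 1] : set R) (fun x => complex.Im (f x)).

(* Restriction \_ extends a function by 0 outside [0, 1]. *)
Definition Lnorm01 p f : \bar R :=
  Lnorm (@lebesgue_measure R) p ((fun x => (normc (f x))%:E) \_ `[0%R, 1%R]).

Definition inL2 f := cmeasurable f /\ (Lnorm01 2%:E f < +oo)%E.

Definition cintegral f : R[i] :=
  Complex (\int[@lebesgue_measure R]_(x in `[0%R, 1%R]) complex.Re (f x))
          (\int[@lebesgue_measure R]_(x in `[0%R, 1%R]) complex.Im (f x)).

Definition inner f g : R[i] := cintegral (fun x => f x * conjc (g x)).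

Definition orthonormal_system (I : eqType) (phi : I -> R -> R[i]) :=
  (forall n, inL2 (phi n)) /\
  (forall m n, inner (phi m) (phi n) = (m == n)%:R).

Definition partial_sum (k : index_kind) (c : index_type k -> R[i])
    (phi : index_type k -> R -> R[i]) (m n : nat) : R -> R[i] :=
  fun x => \sum_(i <- window k m n) c i * phi i x.

Definition series_cvg_to (nrm : (R -> R[i]) -> \bar R) (k : index_kind)
    (c : index_type k -> R[i]) (phi : index_type k -> R -> R[i]) f :=
  nrm (fun x => f x - partial_sum c phi mn.1 mn.2 x)
    @[mn --> filter_prod \oo \oo] --> (0 : \bar R).

Definition is_sum (k : index_kind) (c : index_type k -> R[i])
    (phi : index_type k -> R -> R[i]) f :=
  inL2 f /\ series_cvg_to (Lnorm01 2%:E) c phi f.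

Definition rearrangement f t : \bar R :=
  ereal_inf [set s%:E | s in [set s : R | (0 <= s)%R /\
    (@lebesgue_measure R (`[0%R, 1%R] `&` [set x | (s < normc (f x))%R])
      <= t%:E)%E]].

(* Meant for k >= 1; the value is +oo when c is unbounded. *)
Definition seq_rearrangement (I : Type) (c : I -> R[i]) (k : nat) : \bar R :=
  ereal_inf [set s%:E | s in [set s : R | (0 <= s)%R /\
    ([set n | (s < normc (c n))%R] #<= `I_k.-1)%card]].

Definition log_weight alpha t : R := (1 + `|ln t|) `^ alpha.

Local Open Scope ereal_scope.

Definition fun_term alpha f t : \bar R :=
  (log_weight alpha t)%:E *
  (\int[@lebesgue_measure R]_(u in `]0%R, t[) rearrangement f u ^+ 2) `^ 2^-1.

Definition fun_norm q alpha f : \bar R :=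
  match q with
  | r%:E => (\int[@lebesgue_measure R]_(t in `]0%R, 1%R[)
              (fun_term alpha f t `^ r * (t^-1)%:E)) `^ r^-1
  | +oo => ereal_sup [set fun_term alpha f t | t in `]0%R, 1%R[]
  | -oo => 0
  end.

Definition seq_term (I : Type) alpha (c : I -> R[i]) (k : nat) : \bar R :=
  (log_weight alpha k%:R)%:E *
  (\sum_(k <= i <oo) seq_rearrangement c i ^+ 2) `^ 2^-1.

Definition seq_norm (I : Type) q alpha (c : I -> R[i]) : \bar R :=
  match q with
  | r%:E => (\sum_(1 <= k <oo)
              (seq_term alpha c k `^ r * (k%:R^-1)%:E)) `^ r^-1
  | +oo => ereal_sup [set seq_term alpha c k | k in [set k | (1 <= k)%N]]
  | -oo => 0
  end.

End functions.

(* Main.v *)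
(* Let S_k be the l_2 norm of the tail (c_i^* )_{i >= k} and F(t) the L_2 norm of
   f^* over (0, t).  Splitting off the N largest coefficients writes f = g + h
   with |g| <= M (c_1^* + ... + c_N^* ) and ||h||_2 <= S_{N+1}, so that
     F(t) <= C (M t^{1/2} (c_1^* + ... + c_N^* ) + S_{N+1}).
   Take b = 4^p with p large compared to |alpha| and J with M^2 <= b^J.  At
   t = b^{-(J+j)} and N = b^j the right-hand side is C V_j, where
   V_{j+1} <= 2^{-p} V_j + 2 S_{b^j} by Cauchy-Schwarz; since the weight grows at
   most by 2^|alpha| from one block to the next, the weighted l_q norm of V is
   controlled by that of (S_{b^j})_j, for every q > 0.  The J remaining blocks
   use F(t) <= C S_1 and cost the power |alpha| + 1/q of 1 + J ~ 1 + log M.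
   This power is also O(M), which yields the minimum.  Convergence follows by
   applying the bound to the coefficients outside a window, whose sequence norm
   tends to 0 by dominated convergence, and f exists by the Riesz-Fischer
   argument. *)
Require Import Defs.
From HB Require Import structures.
From mathcomp Require Import all_boot all_order all_algebra.
From mathcomp Require Import complex.
From mathcomp Require Import all_classical all_reals all_analysis.
From mathcomp Require Import ess_sup_inf measurable_realfun.
From mathcomp Require Import ring lra zify.

Import Order.TTheory GRing.Theory Num.Theory.
Import numFieldNormedType.Exports.

Local Open Scope classical_set_scope.
Local Open Scope ring_scope.

Set Implicit Arguments.
Unset Strict Implicit.
Unset Printing Implicit Defensive.

(** * Dyadic sums *)

(** The shift by J is what removes M. At t = b^-(J+j) one has M t^(1/2) <= b^(-j/2), so beyond the
    first J blocks no constant involves M any more, and M survives only through the number J of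
    initial blocks. The ratio b has to be large because two effects compete from one block to the
    next: the logarithmic weight can grow by 2^|alpha|, while the contribution of the coefficients
    already split off shrinks by b^(-1/2) = 2^-p. The requirement 2^|alpha| 2^-p <= 1/2 makes the
    weighted recursion a contraction. A power of 4 is taken so that b^(1/2) is itself an integer
    power of 2. For q < 1 the space l_q is not normed, so the recursion is not summed with the
    triangle inequality. It is raised to the power q term by term at the price of replacing the
    contraction factor 1/2 by 3/4; since (3/4)^q < 1, one argument covers all q > 0. *)

Section discrete.
Context {R : realType}.
Implicit Types (x y a b r : R).

(** Whichever of [b] and [a / 4] is larger decides which summand alone dominates: a/2 + b is at most
    3a/4 in one case and at most 3b in the other. Nothing is used about convexity, hence every r > 0
    is allowed. *)
Lemma powR_half_add r a b : 0 < r -> 0 <= a -> 0 <= b ->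
  (a / 2 + b) `^ r <= (3 / 4) `^ r * a `^ r + 3 `^ r * b `^ r.
Proof.
move=> r0 a0 b0; rewrite -!powRM//; [|lra..].
have [ba|ab] := leP b (a / 4).
- apply: (@le_trans _ _ ((3 / 4 * a) `^ r)); last by rewrite lerDl powR_ge0.
  apply: ge0_ler_powR; rewrite ?nnegrE ?(ltW r0)//; lra.
- apply: (@le_trans _ _ ((3 * b) `^ r)); last by rewrite lerDr powR_ge0.
  apply: ge0_ler_powR; rewrite ?nnegrE ?(ltW r0)//; lra.
Qed.

Lemma powR_ge1 r a : 1 <= a -> 0 <= r -> 1 <= a `^ r.
Proof. by move=> a1 r0; rewrite -[leLHS](powRr0 a) ler_powR. Qed.

Lemma powR_lt1 r a : 0 < r -> 0 <= a < 1 -> a `^ r < 1.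
Proof.
move=> r0 /andP[a0 a1]; have -> : 1 = 1 `^ r by rewrite powR1.
by apply: gt0_ltr_powR => //; rewrite nnegrE ?ler01.
Qed.

(** Raising the recursion to the power r and summing shifts the index of [U] by one. The shifted sum
    is at most the full one and is absorbed on the left because (3/4)^r < 1; the sums are finite, so
    the subtraction is legitimate. *)
Lemma sum_recursion_le r (U x : nat -> R) n : 0 < r ->
  (forall j, 0 <= U j) -> (forall j, 0 <= x j) ->
  U 0%N <= x 0%N -> (forall j, U j.+1 <= U j / 2 + x j) ->
  (1 - (3 / 4) `^ r) * (\sum_(j < n) U j `^ r) <=
    (1 + 3 `^ r) * \sum_(j < n) x j `^ r.
Proof.
move=> r0 U0 x0 Ux0 Ux.
case: n => [|n]; first by rewrite !big_ord0 !mulr0.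
set t := (3 / 4) `^ r; set s := 3 `^ r.
have t0 : 0 <= t by exact: powR_ge0.
have s0 : 0 <= s by exact: powR_ge0.
suff : \sum_(j < n.+1) U j `^ r <=
    x 0%N `^ r + t * (\sum_(j < n) U j `^ r) + s * \sum_(j < n) x j `^ r.
  move=> h; rewrite mulrBl mul1r mulrDl mul1r lerBlDr (le_trans h)//.
  rewrite addrAC lerD// ?lerD ?ler_wpM2l// big_ord_recr/= ?lerDl ?powR_ge0//.
  by rewrite -(big_ord_recr n (fun i => x i `^ r)) big_ord_recl lerDl sumr_ge0//
    => i _; exact: powR_ge0.
rewrite big_ord_recl/= -addrA lerD//.
  by apply: ge0_ler_powR; rewrite ?nnegrE// ltW.
rewrite !mulr_sumr -big_split/=; apply: ler_sum => j _.
apply: le_trans (powR_half_add r0 (U0 j) (x0 j)).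
by apply: ge0_ler_powR; rewrite ?nnegrE ?addr_ge0 ?divr_ge0 ?(ltW r0).
Qed.

(** Model of [log_weight] at the scales b^j and b^-j, where 1 + |log| equals 1 + j ln b. *)
Definition dweight (alpha : R) (j : nat) : R := (1 + j%:R) `^ alpha.

Lemma dweight_gt0 alpha j : 0 < dweight alpha j.
Proof. by apply: powR_gt0; rewrite ltr_pwDl. Qed.

(** Comparability is assumed in both directions because a negative [alpha] exchanges the roles of a
    and b. *)
Lemma le_powR_ratio alpha (K a b : R) : 1 <= K -> 0 < a -> 0 < b ->
  a <= K * b -> b <= K * a -> a `^ alpha <= K `^ `|alpha| * b `^ alpha.
Proof.
move=> K1 a0 b0 aKb bKa.
have K0 : 0 <= K by exact: le_trans K1.
have [a0' b0'] := (ltW a0, ltW b0).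
have [al0|al0] := leP 0 alpha.
  rewrite ger0_norm// -powRM//; apply: ge0_ler_powR => //.
  by rewrite nnegrE mulr_ge0.
rewrite ltr0_norm// -[in _ `^ alpha](opprK alpha) -[in b `^ _](opprK alpha).
have : 0 <= - alpha by rewrite oppr_ge0 ltW.
move: (- alpha) => b' b'0; rewrite (powRN a) (powRN b) ler_pdivlMr ?powR_gt0//.
rewrite ler_pdivrMl ?powR_gt0// mulrC -powRM//.
by apply: ge0_ler_powR => //; rewrite ?nnegrE ?mulr_ge0// mulrC.
Qed.

Lemma dweightS alpha j : dweight alpha j.+1 <= 2 `^ `|alpha| * dweight alpha j.
Proof.
have := ler0n R j => j0; rewrite /dweight -natr1.
by apply: le_powR_ratio; lra.
Qed.

Lemma dweightD alpha i j :
  dweight alpha (i + j) <= (1 + i%:R) `^ `|alpha| * dweight alpha j.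
Proof.
have i0 := ler0n R i; have j0 := ler0n R j; rewrite /dweight natrD.
apply: le_powR_ratio; [lra|lra|lra| |]; nra.
Qed.

Lemma dweight_le alpha i j : (i <= j)%N ->
  dweight alpha i <= (1 + j%:R) `^ `|alpha|.
Proof.
move=> ij; have ij' : i%:R <= j%:R :> R by rewrite ler_nat.
have i0 := ler0n R i.
apply: (@le_trans _ _ ((1 + j%:R) `^ `|alpha| * 1 `^ alpha)).
  apply: le_powR_ratio; [lra|lra|lra|lra|nra].
by rewrite powR1 mulr1.
Qed.

(** * The block recursion for abstract sequences: [s] stands for the tails at b^j, [F] for the
    bounds at b^-m, [V] for their majorant *)

Section dyadic.
Variables (alpha beta K : R) (s F V : nat -> R) (J : nat).
Hypotheses (s0 : forall j, 0 <= s j) (F0 : forall j, 0 <= F j)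
  (V0 : forall j, 0 <= V j) (K0 : 0 <= K)
  (betaE : 2 `^ `|alpha| * beta <= 1 / 2)
  (V0s : V 0 <= 2 * s 0) (VS : forall j, V j.+1 <= beta * V j + 2 * s j)
  (FJ : forall m, (m < J)%N -> F m <= K * s 0)
  (FV : forall j, F (J + j) <= K * V j).

Let w := dweight alpha.
Let x j := 2 * 2 `^ `|alpha| * (w j * s j).

Let w0 j : 0 <= w j. Proof. exact/ltW/dweight_gt0. Qed.

Let a1 : 1 <= 2 `^ `|alpha| :> R.
Proof. by apply: powR_ge1; rewrite ?ler1n. Qed.

Let a0 : 0 <= 2 `^ `|alpha| :> R. Proof. exact: powR_ge0. Qed.

Let U j := w j * V j.

Let Ux0 : U 0%N <= x 0%N.
Proof.
rewrite /U /x; apply: (@le_trans _ _ (w 0%N * (2 * s 0%N))).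
  by rewrite ler_wpM2l.
rewrite mulrCA -mulrA ler_wpM2l// ler_peMl// mulr_ge0//.
Qed.

Let UxS j : U j.+1 <= U j / 2 + x j.
Proof.
rewrite /U /x.
apply: (@le_trans _ _ ((2 `^ `|alpha| * w j) * (beta * V j + 2 * s j))).
  by apply: ler_pM => //; exact: dweightS.
rewrite mulrDr lerD//.
  have -> : 2 `^ `|alpha| * w j * (beta * V j) = 2 `^ `|alpha| * beta * (w j * V j).
    by ring.
  have wV : 0 <= w j * V j by rewrite mulr_ge0.
  by have := ler_wpM2r wV betaE; lra.
by rewrite le_eqVlt; apply/orP; left; apply/eqP; ring.
Qed.

Let x0 j : 0 <= x j. Proof. by rewrite /x !mulr_ge0. Qed.
Let U0 j : 0 <= U j. Proof. by rewrite /U mulr_ge0. Qed.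

Lemma dyadic_sup_le X : (forall j, w j * s j <= X) ->
  forall m, w m * F m <= 4 * 2 `^ `|alpha| * K * (1 + J%:R) `^ `|alpha| * X.
Proof.
move=> sX m; set A := 2 `^ _; set L := (1 + _) `^ _.
have L1 : 1 <= L.
  by apply: powR_ge1; rewrite ?lerDl.
have X0 : 0 <= X by apply: le_trans (sX 0%N); rewrite mulr_ge0.
(* The constant is the fixed point of u |-> u / 2 + 2 * A * X, which majorises the recursion. *)
have UX j : U j <= 4 * A * X.
  elim: j => [|j IH].
    apply: (le_trans Ux0); rewrite /x -/A ler_pM// ?mulr_ge0//.
    by rewrite ler_wpM2r// ler_nat.
  apply: (le_trans (UxS j)); have := ler_wpM2l _ (sX j) => /(_ (2 * A)).
  rewrite /x -/A => /(_ _) h; have := h (mulr_ge0 (ler0n _ _) a0).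
  by move: IH; lra.
have [mJ|Jm] := ltnP m J.
  apply: (@le_trans _ _ (L * (K * X))).
    apply: ler_pM => //; first by apply: dweight_le; exact: ltnW.
    apply: le_trans (FJ mJ) _; rewrite ler_wpM2l//.
    by have := sX 0%N; rewrite /w /dweight addr0 powR1 mul1r.
  have -> : 4 * A * K * L * X = 4 * A * (L * (K * X)) by ring.
  rewrite ler_peMl// ?mulr_ge0//; first exact: le_trans L1.
  by move: a1; rewrite -/A; lra.
rewrite -(subnKC Jm); set j := (m - J)%N.
apply: (@le_trans _ _ (L * w j * (K * V j))).
  by apply: ler_pM => //; exact: dweightD.
have -> : L * w j * (K * V j) = L * K * U j by rewrite /U; ring.
have -> : 4 * A * K * L * X = L * K * (4 * A * X) by ring.
by rewrite ler_wpM2l// mulr_ge0// (le_trans _ L1).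
Qed.

(** Each of the first J blocks is bounded through [s 0] alone, whose power is just one term of the
    sum on the right. Together they cost J times that term: this is the origin of the factor 1 + J,
    and of 1/q in the final exponent. The later blocks cost only the weight shift, through
    [dweightD]. *)
Lemma dyadic_sum_le r n : 0 < r ->
  \sum_(m < n) (w m * F m) `^ r <=
  (1 + (1 + 3 `^ r) / (1 - (3 / 4) `^ r)) * (2 * 2 `^ `|alpha|) `^ r *
  (K `^ r * ((1 + J%:R) `^ `|alpha|) `^ r * (1 + J%:R)) *
  \sum_(j < n) (w j * s j) `^ r.
Proof.
move=> r0; set A := 2 * _; set L := (1 + _) `^ _; set D := (1 + 3 `^ r) / _.
case: n => [|n]; first by rewrite !big_ord0 mulr0.
have A0 : 0 <= A by rewrite mulr_ge0.
have A1 : 1 <= A `^ r.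
  by apply: powR_ge1 (ltW r0); rewrite /A; move: a1; lra.
have L0 : 0 <= L by exact: powR_ge0.
have D0 : 0 <= D.
  apply: divr_ge0; first by rewrite addr_ge0// powR_ge0.
  by rewrite subr_ge0 ltW// powR_lt1//; lra.
set X := \sum_(j < n.+1) (w j * s j) `^ r.
have X0 : 0 <= X by rewrite sumr_ge0// => i _; exact: powR_ge0.
have UX N : \sum_(j < N) U j `^ r <= D * A `^ r * \sum_(j < N) (w j * s j) `^ r.
  have := @sum_recursion_le r U x N r0 U0 x0 Ux0 UxS.
  rewrite mulrC -ler_pdivlMr ?subr_gt0 ?powR_lt1//; last by lra.
  move=> /le_trans; apply; rewrite mulrAC -/D -mulrA ler_wpM2l//.
  rewrite mulr_sumr ler_sum// => i _.
  by rewrite /x -powRM// mulr_ge0.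
have s0X : s 0%N `^ r <= X.
  rewrite /X big_ord_recl /= {1}/w /dweight addr0 powR1 mul1r lerDl sumr_ge0//.
  by move=> i _; exact: powR_ge0.
have h1 m : (m < J)%N -> (w m * F m) `^ r <= K `^ r * L `^ r * X.
  move=> mJ; apply: (@le_trans _ _ ((L * (K * s 0%N)) `^ r)).
    apply: ge0_ler_powR; rewrite ?nnegrE ?mulr_ge0 ?(ltW r0)//.
    apply: ler_pM => //; last exact: FJ.
    by apply: dweight_le; exact: ltnW.
  rewrite powRM ?mulr_ge0// powRM// mulrCA mulrA ler_wpM2l//.
  by rewrite mulr_ge0// powR_ge0.
have h2 j : (w (J + j) * F (J + j)) `^ r <= K `^ r * L `^ r * U j `^ r.
  rewrite -!powRM ?mulr_ge0//; apply: ge0_ler_powR;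
    rewrite ?nnegrE ?mulr_ge0 ?(ltW r0)//.
  have -> : K * L * U j = (L * w j) * (K * V j) by rewrite /U; ring.
  by apply: ler_pM => //; exact: dweightD.
have KL0 : 0 <= K `^ r * L `^ r by rewrite mulr_ge0 ?powR_ge0.
(* Enlarging the range to J + n.+1 blocks avoids comparing n with J. *)
have hs : \sum_(m < n.+1) (w m * F m) `^ r <=
   \sum_(m < J) (w m * F m) `^ r + \sum_(j < n.+1) (w (J + j) * F (J + j)) `^ r.
  pose g m := (w m * F m) `^ r.
  have -> : \sum_(m < J) (w m * F m) `^ r +
      \sum_(j < n.+1) (w (J + j) * F (J + j)) `^ r = \sum_(m < J + n.+1) g m.
    by rewrite big_split_ord.
  rewrite -[leRHS](big_mkord xpredT g) [leRHS](@big_cat_nat _ _ _ n.+1)//= ?leq_addl//.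
  by rewrite big_mkord lerDl sumr_ge0// => i _; exact: powR_ge0.
apply: (le_trans hs).
apply: (@le_trans _ _ (J%:R * (K `^ r * L `^ r * X) +
   K `^ r * L `^ r * (D * A `^ r * X))).
  apply: lerD.
    apply: (@le_trans _ _ (\sum_(m < J) (K `^ r * L `^ r * X))).
      by apply: ler_sum => i _; exact: h1.
    by rewrite sumr_const card_ord [leRHS]mulr_natl.
  apply: (@le_trans _ _ (\sum_(j < n.+1) (K `^ r * L `^ r * U j `^ r))).
    by apply: ler_sum => i _; exact: h2.
  by rewrite -mulr_sumr ler_wpM2l.
set P := K `^ r * L `^ r * X.
have P0 : 0 <= P by rewrite mulr_ge0.
have -> : K `^ r * L `^ r * (D * A `^ r * X) = D * A `^ r * P by rewrite /P; ring.
have -> : (1 + D) * A `^ r * (K `^ r * L `^ r * (1 + J%:R)) * X =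
  A `^ r * (1 + D) * (1 + J%:R) * P by rewrite /P; ring.
rewrite -mulrDl ler_wpM2r//.
have J0 := ler0n R J.
have h : J%:R <= A `^ r * J%:R by rewrite ler_peMl.
have : 0 <= A `^ r * D * J%:R by rewrite mulr_ge0// mulr_ge0// powR_ge0.
by move: h A1; lra.
Qed.

End dyadic.
End discrete.

(** * Comparison of the logarithmic weights with their dyadic model *)

Section weights.
Context {R : realType}.
Implicit Types (lam y alpha : R).

(** For j lam <= y <= (j+1) lam one has 1 + y <= (1 + lam)(1 + j) and 1 + j <= (1 + 1/lam)(1 + y);
    this single constant serves for both. *)
Definition wratio lam : R := 1 + lam + lam^-1.

Lemma wratio_ge1 lam : 0 < lam -> 1 <= wratio lam.
Proof. by move=> l0; rewrite /wratio -addrA lerDl addr_ge0 ?invr_ge0 ?ltW. Qed.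

Lemma wratio_bounds lam y j : 0 < lam ->
  j%:R * lam <= y -> y <= j.+1%:R * lam ->
  1 + y <= wratio lam * (1 + j%:R) /\ 1 + j%:R <= wratio lam * (1 + y).
Proof.
move=> l0; rewrite /wratio -natr1 => jy yj.
have j0 : 0 <= j%:R :> R by [].
have i0 : 0 < lam^-1 by rewrite invr_gt0.
have y0 : 0 <= y by apply: le_trans jy; rewrite mulr_ge0// ltW.
have jl0 : 0 <= j%:R * lam by rewrite mulr_ge0// ltW.
split.
  have := mulr_ge0 (ltW i0) j0; lra.
have h : j%:R <= lam^-1 * y by rewrite mulrC ler_pdivlMr.
have := mulr_ge0 (ltW l0) y0; lra.
Qed.

Lemma dweight_le_log lam alpha y j : 0 < lam ->
  j%:R * lam <= y -> y <= j.+1%:R * lam ->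
  dweight alpha j <= wratio lam `^ `|alpha| * (1 + y) `^ alpha.
Proof.
move=> l0 jy yj; have [h1 h2] := wratio_bounds l0 jy yj.
have j0 : 0 <= j%:R :> R by [].
have y0 : 0 <= y by apply: le_trans jy; rewrite mulr_ge0// ltW.
apply: le_powR_ratio => //; [exact: wratio_ge1|lra].
Qed.

Lemma log_le_dweight lam alpha y j : 0 < lam ->
  j%:R * lam <= y -> y <= j.+1%:R * lam ->
  (1 + y) `^ alpha <= wratio lam `^ `|alpha| * dweight alpha j.
Proof.
move=> l0 jy yj; have [h1 h2] := wratio_bounds l0 jy yj.
have j0 : 0 <= j%:R :> R by [].
have y0 : 0 <= y by apply: le_trans jy; rewrite mulr_ge0// ltW.
apply: le_powR_ratio => //; [exact: wratio_ge1|lra].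
Qed.

Lemma log_weight_gt0 alpha t : 0 < log_weight alpha t :> R.
Proof. by apply: powR_gt0; rewrite ltr_pwDl. Qed.

Lemma log_weight1 alpha : log_weight alpha (1 : R) = 1.
Proof. by rewrite /log_weight ln1 normr0 addr0 powR1. Qed.

End weights.

(** * Condensation of the sequence norm to the indices b^j *)

Section dyadic_series.
Context {R : realType}.
Variables (b : nat) (alpha : R).
Hypothesis b1 : (1 < b)%N.

Let lam : R := ln b%:R.

Let lam0 : 0 < lam.
Proof. by rewrite ln_gt0// ltr1n. Qed.

Let b0 : (0 < b)%N. Proof. exact: ltnW. Qed.

Let lnb j : ln ((b ^ j)%:R : R) = j%:R * lam.
Proof. by rewrite natrX lnXn ?ltr0n// mulr_natl. Qed.

Lemma dweight_block k j : (b ^ j <= k <= b ^ j.+1)%N ->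
  dweight alpha j <= wratio lam `^ `|alpha| * log_weight alpha k%:R.
Proof.
move=> /andP[jk kj].
have k0 : (0 < k)%N by apply: leq_trans jk; rewrite expn_gt0 b0.
rewrite /log_weight [X in 1 + X]ger0_norm ?ln_ge0 ?ler1n//.
by apply: dweight_le_log; rewrite // -lnb ler_ln ?posrE ?ltr0n ?expn_gt0 ?b0// ler_nat.
Qed.

(** Cauchy condensation. Since b >= 2, the block b^n < k <= b^(n+1) contains at least half of the
    integers up to b^(n+1), so its sum of 1/k is at least 1/2, and on it S k is at least S at the
    right end. The term j = 0 is paid by k = 1, whence the leading 1 in the constant. *)
Lemma dyadic_le_series (r : R) (S : nat -> R) n : 0 < r ->
  (forall k, 0 <= S k) -> (forall k l, (1 <= k <= l)%N -> S l <= S k) ->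
  \sum_(j < n.+1) (dweight alpha j * S (b ^ j)%N) `^ r <=
  (1 + 2 * (2 `^ `|alpha| * wratio lam `^ `|alpha|) `^ r) *
  \sum_(1 <= k < (b ^ n).+1) ((log_weight alpha k%:R * S k) `^ r / k%:R).
Proof.
move=> r0 S0 Smono; set A := _ * wratio _ `^ _; set D := 1 + _.
have A0 : 0 <= A by rewrite mulr_ge0// powR_ge0.
have D1 : 1 <= D by rewrite lerDl mulr_ge0// powR_ge0.
elim: n => [|n IH].
  rewrite big_ord_recl big_ord0 addr0 expn0 big_nat1 log_weight1 invr1 mulr1.
  by rewrite /dweight addr0 powR1 ler_peMl// powR_ge0.
rewrite big_ord_recr/=.
have bn : (b ^ n <= b ^ n.+1)%N by rewrite leq_exp2l.
have bn0 : (0 < b ^ n)%N by rewrite expn_gt0 b0.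
rewrite (@big_cat_nat _ _ _ (b ^ n).+1)//= mulrDr lerD//.
set N := (b ^ n.+1)%N; set T := dweight _ _ * _.
have T0 : 0 <= T by rewrite mulr_ge0// ltW// dweight_gt0.
have N0 : 0 < N%:R :> R by rewrite ltr0n expn_gt0 b0.
apply: (@le_trans _ _ (D * \sum_((b ^ n).+1 <= k < N.+1) (T `^ r / A `^ r / N%:R))).
  rewrite big_const_nat iter_addr addr0 -[_ *+ _]mulr_natl.
  have hN : N%:R <= 2 * (N.+1 - (b ^ n).+1)%:R :> R.
    rewrite subSS -natrM ler_nat /N expnS.
    have : (2 * b ^ n <= b * b ^ n)%N by rewrite leq_mul2r b1 orbT.
    by lia.
  have A1 : 0 < A `^ r.
    rewrite powR_gt0// mulr_gt0// powR_gt0//.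
    exact: lt_le_trans (wratio_ge1 lam0).
  have -> : D * ((N.+1 - (b ^ n).+1)%:R * (T `^ r / A `^ r / N%:R)) =
     (D / A `^ r) * (((N.+1 - (b ^ n).+1)%:R / N%:R)) * T `^ r by ring.
  apply: (@le_trans _ _ (2 * (1 / 2) * T `^ r)).
    by rewrite mul1r divff// mul1r.
  rewrite ler_wpM2r ?powR_ge0// ler_pM//.
    by rewrite ler_pdivlMr// lerDr.
  by rewrite ler_pdivlMr// mulrC mul1r ler_pdivrMr// mulrC.
rewrite ler_wpM2l ?(le_trans _ D1)//.
apply: ler_sum_nat => k /andP[nk kN].
have k0 : (0 < k)%N by exact: leq_ltn_trans nk.
apply: ler_pM.
- by rewrite divr_ge0 ?powR_ge0.
- by rewrite invr_ge0.
- rewrite ler_pdivrMr; last first.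
    rewrite powR_gt0// mulr_gt0// powR_gt0//.
    exact: lt_le_trans (wratio_ge1 lam0).
  rewrite -powRM//; last by rewrite mulr_ge0// ltW// log_weight_gt0.
  have SA0 : 0 <= log_weight alpha k%:R * S k * A.
    by rewrite mulr_ge0// mulr_ge0// ltW// log_weight_gt0.
  apply: ge0_ler_powR; rewrite ?nnegrE ?(ltW r0)//.
  have -> : log_weight alpha k%:R * S k * A = (A * log_weight alpha k%:R) * S k.
    by ring.
  apply: ler_pM => //; first exact/ltW/dweight_gt0.
    (* The index k lies in block n while the weight is that of n.+1; one step of [dweightS] bridges
       the gap. *)
    apply: (le_trans (dweightS _ _)); rewrite -mulrA ler_wpM2l ?powR_ge0//.
    by apply: dweight_block; rewrite ltnW//= -ltnS.
  by apply: Smono; rewrite k0 -ltnS.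
- have k0' : 0 < k%:R :> R by rewrite ltr0n.
  by rewrite lef_pV2 ?posrE// ler_nat -ltnS.
Qed.

Lemma dyadic_le_sup (S : nat -> R) X :
  (forall k, 0 <= S k) ->
  (forall k, (1 <= k)%N -> log_weight alpha k%:R * S k <= X) ->
  forall j, dweight alpha j * S (b ^ j)%N <= wratio lam `^ `|alpha| * X.
Proof.
move=> S0 SX j; set k := (b ^ j)%N.
apply: (@le_trans _ _ (wratio lam `^ `|alpha| * (log_weight alpha k%:R * S k))).
  rewrite mulrA ler_wpM2r//; apply: dweight_block.
  by rewrite /k leqnn leq_exp2l//=.
by rewrite ler_wpM2l ?powR_ge0// SX// expn_gt0 b0.
Qed.

End dyadic_series.

(** * Rearrangements of functions *)

Section poweR_monotone.
Context {R : realType}.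
Local Open Scope ereal_scope.

Lemma ge0_lee_poweR (r : R) (x y : \bar R) : (0 <= r)%R -> 0 <= x -> x <= y ->
  x `^ r <= y `^ r.
Proof.
move=> r0 x0 xy; have y0 := le_trans x0 xy.
by apply: (@gt0_ler_poweR R r r0) => //; rewrite in_itv/= leey andbT.
Qed.

End poweR_monotone.

Section monotone_measurable.
Context {R : realType}.
Local Open Scope ereal_scope.

Lemma nonincreasing_emeasurable (D : set R) (f : R -> \bar R) :
  measurable D -> (forall x y, (x <= y)%R -> f y <= f x) -> measurable_fun D f.
Proof.
move=> mD fni; apply: (measurability _ (ErealGenOInfty.measurableE R)) => //.
move=> /= _ [_ [x ->]] <-; apply: measurableI => //.
apply: is_interval_measurable => s t/=.
rewrite !in_itv/= !andbT => fs ft u /andP[su ut].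
by rewrite in_itv/= andbT (lt_le_trans ft)// fni.
Qed.

Lemma nondecreasing_emeasurable (D : set R) (f : R -> \bar R) :
  measurable D -> (forall x y, (x <= y)%R -> f x <= f y) -> measurable_fun D f.
Proof.
move=> mD fni; apply: (measurability _ (ErealGenOInfty.measurableE R)) => //.
move=> /= _ [_ [x ->]] <-; apply: measurableI => //.
apply: is_interval_measurable => s t/=.
rewrite !in_itv/= !andbT => fs ft u /andP[su ut].
by rewrite in_itv/= andbT (lt_le_trans fs)// fni.
Qed.

End monotone_measurable.

Section rearrangement.
Context {R : realType}.
Local Notation mu := (@lebesgue_measure R).
Implicit Types (f : R -> R[i]) (s t u : R).
Local Open Scope ereal_scope.

Lemma rearrangement_ge0 f t : 0 <= rearrangement f t.
Proof. by apply/ereal_infP => _ [s [s0 _] <-]; rewrite lee_fin. Qed.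

Lemma rearrangement_noninc f t u : (t <= u)%R ->
  rearrangement f u <= rearrangement f t.
Proof.
move=> tu; apply: ereal_inf_le_tmp => _ [s [s0 st] <-]; exists s => //; split => //.
by apply: le_trans st _; rewrite lee_fin.
Qed.

Lemma measurable_rearrangement2 (D : set R) f : measurable D ->
  measurable_fun D (fun u => rearrangement f u ^+ 2).
Proof.
move=> mD; apply: nonincreasing_emeasurable => // x y xy.
by rewrite !expe2; apply: lee_pmul; rewrite ?rearrangement_ge0// rearrangement_noninc.
Qed.

Lemma sqr_rearrangement_ge0 f t : 0 <= rearrangement f t ^+ 2.
Proof. by rewrite expe_ge0// rearrangement_ge0. Qed.

Lemma rearrangement_lt f s u : (0 <= s)%R -> s%:E < rearrangement f u ->
  u%:E < mu (`[0%R, 1%R] `&` [set x | (s < Normc.normc (f x))%R]).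
Proof.
move=> s0; rewrite !ltNge; apply: contra => h.
by apply: ereal_inf_lbound; exists s.
Qed.

Lemma primitive_nondecreasing f (t u : R) : (t <= u)%R ->
  \int[mu]_(x in `]0%R, t[) rearrangement f x ^+ 2 <=
  \int[mu]_(x in `]0%R, u[) rearrangement f x ^+ 2.
Proof.
move=> tu; apply: ge0_subset_integral => //.
- exact: measurable_rearrangement2.
- by move=> x _; exact: sqr_rearrangement_ge0.
- by apply: subset_itvl; rewrite bnd_simp.
Qed.

Lemma primitive_ge0 f t : 0 <= \int[mu]_(x in `]0%R, t[) rearrangement f x ^+ 2.
Proof. by apply: integral_ge0 => x _; exact: sqr_rearrangement_ge0. Qed.

Lemma fun_term_ge0 alpha f t : 0 <= fun_term alpha f t.
Proof. by rewrite mule_ge0 ?poweR_ge0// lee_fin ltW// log_weight_gt0. Qed.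

Lemma measurable_fun_term alpha f (D : set R) : measurable D ->
  measurable_fun D (fun_term alpha f).
Proof.
move=> mD; apply: emeasurable_funM.
  apply/measurable_EFinP.
  apply: (measurableT_comp (measurable_powR alpha)).
  apply: measurable_funD => //; apply: measurableT_comp => //.
  exact: measurable_funTS (@measurable_ln R).
apply: nondecreasing_emeasurable => // x y xy.
by apply: ge0_lee_poweR; rewrite ?invr_ge0 ?primitive_ge0// primitive_nondecreasing.
Qed.

End rearrangement.

(** * The function norm over the blocks (b^-(m+1), b^-m] *)

Section dyadic_integral.
Context {R : realType}.
Local Notation mu := (@lebesgue_measure R).
Variables (b : nat) (alpha : R) (f : R -> R[i]) (F : nat -> R).
Hypotheses (b1 : (1 < b)%N) (F0 : forall m, 0 <= F m).
Hypothesis fF : forall m,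
  ((\int[mu]_(x in `]0%R, (b%:R ^- m : R)[) rearrangement f x ^+ 2) `^ 2^-1 <= (F m)%:E)%E.

Let lam : R := ln b%:R.
Let W := wratio lam `^ `|alpha|.

Let d m : R := b%:R ^- m.

Let b0 : 0 < b%:R :> R. Proof. by rewrite ltr0n ltnW. Qed.

Let lam0 : 0 < lam.
Proof. by rewrite ln_gt0// ltr1n. Qed.

Let d0 m : 0 < d m. Proof. by rewrite invr_gt0 exprn_gt0. Qed.

Let lnd m : - ln (d m) = m%:R * lam.
Proof. by rewrite /d lnV ?posrE ?exprn_gt0// opprK lnXn// mulr_natl. Qed.

Lemma fun_term_block m t : d m.+1 < t <= d m -> t <= 1 ->
  (fun_term alpha f t <= (W * (dweight alpha m * F m))%:E)%E.
Proof.
move=> /andP[mt tm] t1.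
have t0 : 0 < t by exact: lt_trans mt.
rewrite /fun_term mulrA [leRHS]EFinM.
apply: lee_pmul.
- by rewrite lee_fin ltW// log_weight_gt0.
- exact: poweR_ge0.
- rewrite lee_fin /log_weight [X in 1 + X]ler0_norm ?ln_le0//.
  apply: log_le_dweight => //; rewrite -lnd lerN2 ler_ln ?posrE//.
  exact: ltW.
- apply: le_trans (fF m); apply: ge0_lee_poweR; rewrite ?invr_ge0//.
    exact: primitive_ge0.
  exact: primitive_nondecreasing.
Qed.

Lemma block_exists t : 0 < t -> t <= 1 -> exists m, d m.+1 < t <= d m.
Proof.
move=> t0 t1; pose m := Num.truncn (- ln t / lam).
have h0 : 0 <= - ln t / lam by rewrite divr_ge0 ?oppr_ge0 ?ln_le0// ltW.
have /andP[h1 h2] := truncn_itv h0.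
exists m; move: h1 h2; rewrite ler_pdivlMr// ltr_pdivrMr// -!lnd.
rewrite lerN2 ltrN2 ler_ln ?posrE// ltr_ln ?posrE// => -> ->//.
Qed.

Lemma fun_norm_le_sup X : (forall m, dweight alpha m * F m <= X) ->
  (fun_norm +oo alpha f <= (W * X)%:E)%E.
Proof.
move=> FX; apply/ereal_supP => y [t /= + <-]; rewrite in_itv/= => /andP[t0 t1].
have [m mt] := block_exists t0 (ltW t1).
apply: (le_trans (fun_term_block mt (ltW t1))).
by rewrite lee_fin ler_wpM2l// powR_ge0.
Qed.

(** On the block (b^-(m+1), b^-m] the density 1/t is at most b^(m+1) and the length at most b^-m, so
    a block contributes at most b times the power of its bound; [W] accounts for the variation of
    the weight inside it. *)
Lemma fun_norm_le_sum (r X : R) : 0 < r ->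
  (forall n, \sum_(m < n) (dweight alpha m * F m) `^ r <= X) ->
  (fun_norm r%:E alpha f <= ((b%:R * W `^ r * X) `^ r^-1)%:E)%E.
Proof.
move=> r0 FX; rewrite /= -poweR_EFin.
set g := fun t : R => (_ * _)%E.
have g0 t : 0 <= t -> (0 <= g t)%E.
  by move=> t0; rewrite mule_ge0 ?poweR_ge0// lee_fin invr_ge0.
(* On t >= 0 the inverse is the power of exponent -1 and inherits its measurability. *)
have mg (D : set R) : measurable D -> D `<=` `[0, +oo[ -> measurable_fun D g.
  move=> mD D0; apply: emeasurable_funM.
    apply: (measurableT_comp (measurable_poweR r)).
    exact: measurable_fun_term.
  apply/measurable_EFinP; apply: (eq_measurable_fun (fun t => t `^ (-1))).
    move=> t; rewrite inE => /D0 /=; rewrite in_itv/= andbT => t0.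
    by rewrite powR_inv1.
  exact: measurable_funTS (measurable_powR _).
apply: ge0_lee_poweR; first by rewrite invr_ge0 ltW.
  apply: integral_ge0 => t /=; rewrite in_itv/= => /andP[t0 _].
  exact/g0/ltW.
pose I m := `]d m.+1, d m]%classic.
have sub : `]0, 1[%classic `<=` \bigcup_m I m.
  move=> t /=; rewrite in_itv/= => /andP[t0 t1].
  by have [m mt] := block_exists t0 (ltW t1); exists m => //=; rewrite in_itv.
have mIm m : measurable (I m) by exact: measurable_itv.
have mI : measurable (\bigcup_m I m) by apply: bigcupT_measurable => m; exact: mIm.
have I0 m t : I m t -> 0 < t.
  by rewrite /I/= in_itv/= => /andP[+ _]; exact: lt_trans.
have I0' : \bigcup_m I m `<=` `[0, +oo[.
  by move=> t [m _ /I0 t0] /=; rewrite in_itv/= ltW.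
apply: (@le_trans _ _ (\int[mu]_(t in \bigcup_m I m) g t)%E).
  apply: ge0_subset_integral => //; first exact: mg.
  by move=> t [m _ /I0 /ltW /g0].
have dle m n : (m <= n)%N -> d n <= d m.
  move=> mn; rewrite /d lef_pV2 ?posrE ?exprn_gt0//.
  by rewrite ler_eXn2l// ltr1n.
rewrite ge0_integral_bigcup//; first last.
- apply/trivIsetP => m n _ _ mn; apply/seteqP; split => // t [].
  rewrite /I/= !in_itv/= => /andP[m1 m2] /andP[n1 n2].
  move: mn; rewrite neq_lt => /orP[] /dle h.
    by have := lt_le_trans m1 (le_trans n2 h); rewrite ltxx.
  by have := lt_le_trans n1 (le_trans m2 h); rewrite ltxx.
- by move=> t [m _ /I0 /ltW /g0].
- exact: mg.
apply: lime_le.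
  apply: is_cvg_nneseries => n _ _; apply: integral_ge0 => t /I0 /ltW; exact: g0.
apply: nearW => n; apply: (@le_trans _ _
   (\sum_(0 <= m < n) (b%:R * W `^ r * (dweight alpha m * F m) `^ r)%:E)%E).
  apply: lee_sum => m _.
  set c := (W * (dweight alpha m * F m)) `^ r.
  have dF : 0 <= dweight alpha m * F m.
    by rewrite mulr_ge0// ltW// dweight_gt0.
  have c0 : 0 <= c by exact: powR_ge0.
  apply: (@le_trans _ _ (\int[mu]_(t in I m) cst (c * b%:R ^+ m.+1)%:E t)%E).
    apply: ge0_le_integral => //.
    - exact: mIm.
    - by move=> t /I0 /ltW /g0.
    - by apply: mg => // t /I0 /ltW t0 /=; rewrite in_itv/= t0.
    - move=> t It; have t0 := I0 _ _ It.
      move: It; rewrite /I/= in_itv/= => It; rewrite /g EFinM.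
      apply: lee_pmul => //; first exact: poweR_ge0.
      + by rewrite lee_fin invr_ge0 ltW.
      + rewrite /c -poweR_EFin; apply: ge0_lee_poweR; first exact: ltW.
          exact: fun_term_ge0.
        apply: fun_term_block => //; case/andP: It => _ /le_trans; apply.
        by have := dle 0%N m (leq0n _); rewrite {2}/d expr0 invr1.
      + rewrite lee_fin -[leRHS]invrK lef_pV2 ?posrE//; last exact: (d0 m.+1).
        by case/andP: It => /ltW.
  rewrite integral_cst; last exact: mIm.
  have muI : mu (I m) = (d m - d m.+1)%:E.
    rewrite /I lebesgue_measure_itv/= lte_fin -EFinB; case: ltgtP => // dd.
      by have := dle _ _ (leqnSn m); rewrite leNgt dd.
    by rewrite dd subrr.
  rewrite [X in (_ * X)%E](_ : _ = (d m - d m.+1)%:E); last exact: muI.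
  rewrite -EFinM lee_fin.
  have -> : b%:R * W `^ r * (dweight alpha m * F m) `^ r = c * b%:R.
    by rewrite /c [in RHS](powRM _ (powR_ge0 _ _) dF) [RHS]mulrC mulrA.
  rewrite -mulrA ler_wpM2l//.
  apply: (@le_trans _ _ (b%:R ^+ m.+1 * d m)).
    by apply: ler_wpM2l; [rewrite exprn_ge0// ltW|rewrite gerDl oppr_le0 ltW].
  by rewrite /d exprS -mulrA divff ?mulr1// gt_eqF// exprn_gt0.
rewrite sumEFin lee_fin -mulr_sumr ler_wpM2l//; last by rewrite big_mkord.
by rewrite mulr_ge0 ?powR_ge0// ltW.
Qed.

End dyadic_integral.

(** * Distribution functions and the L_2 bound for the rearrangement *)

Section layer_cake.
Context {R : realType}.
Local Notation mu := (@lebesgue_measure R).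
Local Open Scope ereal_scope.

(** Tonelli for the region under the graph: its sections at fixed x have length g x, infinite values
    included, and its sections at fixed s are the superlevel sets. *)
Lemma layer_cake (D : set R) (g : R -> \bar R) :
  measurable D -> measurable_fun D g -> (forall x, D x -> 0 <= g x) ->
  \int[mu]_(x in D) g x =
  \int[mu]_(s in `]0%R, +oo[) mu (D `&` [set x | s%:E < g x]).
Proof.
move=> mD mg g0.
pose A : set (R * R) := [set p | (0 < p.2)%R /\ p.2%:E < (g \_ D) p.1].
have mgD : measurable_fun setT (g \_ D) by apply/(measurable_restrictT _ _).1.
have mA : measurable A.
  have -> : A = [set p | (0 < p.2)%R] `&` [set p | p.2%:E < (g \_ D) p.1] by [].
  apply: measurableI.
    have : measurable_fun setT (fun p : R * R => (0 < p.2)%R).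
      exact: measurable_fun_ltr.
    by move=> /(_ measurableT [set true]); rewrite setTI; exact.
  have : measurable_fun setT (fun p : R * R => p.2%:E < (g \_ D) p.1).
    apply: measurable_fun_lte; first exact/measurable_EFinP.
    exact: measurableT_comp.
  by move=> /(_ measurableT [set true]); rewrite setTI; exact.
rewrite integral_mkcond [RHS]integral_mkcond.
transitivity (\int[mu]_x fubini_F mu (EFin \o \1_A) x).
  apply: eq_integral => x _; rewrite indic_fubini_tonelli_FE//=.
  have gx0 : 0 <= (g \_ D) x by rewrite patchE; case: ifPn => // /[1!inE]; exact: g0.
  have -> : xsection A x = [set s | (0 < s)%R /\ s%:E < (g \_ D) x].
    by apply/seteqP; split => s; rewrite /xsection/= inE.
  case: ((g \_ D) x) gx0 => [r r0| _ |//].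
    have -> : [set s | (0 < s)%R /\ s%:E < r%:E] = `]0%R, r[%classic.
      by apply/seteqP; split => s /=; rewrite in_itv/= lte_fin => /andP.
    rewrite lebesgue_measure_itv/= lte_fin; case: ltgtP => [|/lt_geF|<-//].
      by rewrite -EFinB subr0.
    by move: r0; rewrite lee_fin => ->.
  have -> : [set s : R | (0 < s)%R /\ s%:E < +oo] = `]0%R, +oo[%classic.
    apply/seteqP; split => s /=; rewrite in_itv/= andbT; first by case.
    by move=> s0; split => //; exact: ltry.
  by rewrite lebesgue_measure_itv/= ltry.
rewrite indic_fubini_tonelli//; apply: eq_integral => s _.
rewrite indic_fubini_tonelli_GE//= patchE.
case: ifPn; rewrite ?inE ?notin_setE/= in_itv/= andbT => s0.
  congr (mu _); apply/seteqP; split => x; rewrite /ysection/= inE /A/= patchE.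
    by move=> [_]; case: ifPn; rewrite ?inE// => _; rewrite lte_fin ltNge (ltW s0).
  by move=> [Dx sx]; split => //; rewrite ifT// inE.
rewrite (_ : ysection A s = set0) ?measure0//.
by apply/seteqP; split => // x; rewrite /ysection/= inE => -[].
Qed.

End layer_cake.

Section normc_measurable.
Context {R : realType}.
Implicit Types (f g : R -> R[i]).
Local Notation mu := (@lebesgue_measure R).
Local Notation normc := Normc.normc.

Lemma sqr_normc (z : R[i]) :
  normc z ^+ 2 = complex.Re z ^+ 2 + complex.Im z ^+ 2.
Proof. by case: z => a b /=; rewrite sqr_sqrtr// addr_ge0// sqr_ge0. Qed.

Lemma normc_ge0 (z : R[i]) : 0 <= normc z.
Proof. by case: z => a b; exact: sqrtr_ge0. Qed.

Lemma cmeasurable_sqr_normc f : cmeasurable f ->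
  measurable_fun (`[0, 1] : set R) (fun x => normc (f x) ^+ 2).
Proof.
move=> [mR mI]; rewrite (_ : (fun x => _) =
  (fun x => complex.Re (f x) ^+ 2 + complex.Im (f x) ^+ 2)); last first.
  by apply/funext => x; rewrite sqr_normc.
by apply: measurable_funD; apply: measurable_funX.
Qed.

Lemma cmeasurable_normc f : cmeasurable f ->
  measurable_fun (`[0, 1] : set R) (fun x => normc (f x)).
Proof.
move=> mf; rewrite (_ : (fun x => _) = (fun x => (normc (f x) ^+ 2) `^ 2^-1)).
  exact: measurableT_comp (measurable_powR _) (cmeasurable_sqr_normc mf).
apply/funext => x; rewrite -powR_mulrn ?normc_ge0// -powRrM.
by rewrite divff ?pnatr_eq0// powRr1// normc_ge0.
Qed.

Lemma measurable_superlevel f (s : R) : cmeasurable f ->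
  measurable (`[0, 1] `&` [set x | s < normc (f x)]).
Proof.
move=> /cmeasurable_normc mf.
have := mf (measurable_itv _) `]s, +oo[%classic (measurable_itv _).
by congr (measurable (_ `&` _)); apply/seteqP; split => x /=; rewrite in_itv/= andbT.
Qed.

End normc_measurable.

Section rearrangement_L2.
Context {R : realType}.
Implicit Types (f h : R -> R[i]) (s t u : R).
Local Notation mu := (@lebesgue_measure R).
Local Notation normc := Normc.normc.
Local Open Scope ereal_scope.

Definition energy f : \bar R := \int[mu]_(x in `[0%R, 1%R]) (normc (f x) ^+ 2)%:E.

Lemma energy_ge0 f : 0 <= energy f.
Proof. by apply: integral_ge0 => x _; rewrite lee_fin sqr_ge0. Qed.

(** Layer cake on both sides. If the squared rearrangement exceeds s at u, then u is smaller than
    the measure of the set where |h|^2 > s, so the superlevel set on the left sits in an interval of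
    that length. *)
Lemma integral_rearrangement_le h t : cmeasurable h ->
  \int[mu]_(x in `]0%R, t[) rearrangement h x ^+ 2 <= energy h.
Proof.
move=> mh; rewrite /energy [leLHS]layer_cake//; first last.
- by move=> x _; exact: sqr_rearrangement_ge0.
- exact: measurable_rearrangement2.
rewrite [leRHS]layer_cake//; first last.
- by move=> x _; rewrite lee_fin sqr_ge0.
- by apply/measurable_EFinP; exact: cmeasurable_sqr_normc.
have mS (r : R) : measurable (`]0%R, t[ `&` [set x | r%:E < rearrangement h x ^+ 2]).
  have mr : measurable_fun `]0%R, t[%classic (fun x => rearrangement h x ^+ 2).
    exact: measurable_rearrangement2.
  exact: emeasurable_fun_o_infty.
have mT (r : R) : measurable (`[0%R, 1%R] `&` [set x | r%:E < (normc (h x) ^+ 2)%:E]).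
  apply: emeasurable_fun_o_infty => //.
  by apply/measurable_EFinP; exact: cmeasurable_sqr_normc.
apply: ge0_le_integral => //.
- apply: nonincreasing_emeasurable => // r s rs.
  apply: le_measure; rewrite ?inE; [exact: mS|exact: mS|].
  by apply: setIS => x /=; apply: le_lt_trans; rewrite lee_fin.
- apply: nonincreasing_emeasurable => // r s rs.
  apply: le_measure; rewrite ?inE; [exact: mT|exact: mT|].
  by apply: setIS => x /=; apply: le_lt_trans; rewrite lee_fin.
move=> s /=; rewrite in_itv/= andbT => s0.
have sqs : (Num.sqrt s ^+ 2 = s)%R by rewrite sqr_sqrtr// ltW.
have ss0 : (0 <= Num.sqrt s)%R by exact: sqrtr_ge0.
have TE : mu (`[0%R, 1%R] `&` [set x | (Num.sqrt s < normc (h x))%R]) =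
    mu (`[0%R, 1%R] `&` [set x | s%:E < (normc (h x) ^+ 2)%:E]).
  congr (mu (_ `&` _)); apply/seteqP; split => x /=; rewrite lte_fin.
    by rewrite -{2}sqs ltr_pXn2r// nnegrE// normc_ge0.
  by rewrite -{1}sqs ltr_pXn2r// nnegrE// normc_ge0.
set m := mu (`[0%R, 1%R] `&` _).
have m0 : 0 <= m by exact: measure_ge0.
have m1 : m <= 1.
  apply: (@le_trans _ _ (mu `[0%R, 1%R]%classic)).
    apply: le_measure; rewrite ?inE; [exact: mT|exact: measurable_itv|].
    exact: subIsetl.
  by rewrite lebesgue_measure_itv/= lte_fin ltr01 -EFinB subr0.
have mfin : m \is a fin_num by rewrite ge0_fin_numE// (le_lt_trans m1)// ltry.
apply: (@le_trans _ _ (mu `]0%R, fine m[%classic)).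
  apply: le_measure; rewrite ?inE; [exact: mS|exact: measurable_itv|].
  move=> u /= [+ su]; rewrite !in_itv/= => /andP[u0 _]; rewrite u0/=.
  have : (Num.sqrt s)%:E < rearrangement h u.
    rewrite ltNge; apply/negP => hu; move: su; apply/negP; rewrite -leNgt.
    rewrite -sqs EFin_expe expe2.
    by apply: lee_pmul; rewrite ?rearrangement_ge0.
  by move=> /(rearrangement_lt ss0); rewrite TE -/m -lte_fin fineK.
rewrite lebesgue_measure_itv/= lte_fin; case: ifPn => // _.
by rewrite oppr0 adde0 fineK.
Qed.

(** If s is admissible in the infimum for h, then B + s is admissible for f: up to a null set, |f| >
    B + s forces |h| > s. *)
Lemma rearrangement_le_add f h (B t : R) : (0 <= B)%R ->
  cmeasurable f -> cmeasurable h ->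
  {ae mu, forall x, x \in `[0%R, 1%R] -> (normc (f x) <= B + normc (h x))%R} ->
  rearrangement f t <= B%:E + rearrangement h t.
Proof.
move=> B0 mf mh [N [mN N0 fN]].
rewrite -leeBlDl//; apply/ereal_infP => y [s [s0 hs] <-].
rewrite leeBlDl// -EFinD; apply: ereal_inf_lbound.
exists (B + s)%R => //; split; first exact: addr_ge0.
apply: le_trans hs; rewrite -[leRHS]adde0 -N0.
apply: (@le_trans _ _ (mu ((`[0%R, 1%R] `&` [set x | (s < normc (h x))%R]) `|` N))).
  apply: le_measure; rewrite ?inE//.
  - exact: measurable_superlevel.
  - by apply: measurableU => //; exact: measurable_superlevel.
  move=> x [x01 /= fx].
  have [hx|hx] := ltP s (normc (h x)); [by left|right].
  apply: fN => /=; rewrite inE/= => /(_ x01); rewrite leNgt => /negP; apply.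
  by apply: le_lt_trans fx; rewrite lerD2l.
by apply: measureU2 => //; exact: measurable_superlevel.
Qed.

(** The bounded part of f contributes only B^2 times the length of the interval, while the rest
    enters with its whole energy; the factors 2 come from (B + x)^2 <= 2 B^2 + 2 x^2. *)
Lemma primitive_le f h (B t : R) : (0 <= B)%R -> (0 <= t)%R ->
  cmeasurable f -> cmeasurable h ->
  {ae mu, forall x, x \in `[0%R, 1%R] -> (normc (f x) <= B + normc (h x))%R} ->
  \int[mu]_(x in `]0%R, t[) rearrangement f x ^+ 2 <=
  (2 * B ^+ 2 * t)%:E + 2%:E * energy h.
Proof.
move=> B0 t0 mf mh fh.
have sqD (x : \bar R) : 0 <= x ->
    (B%:E + x) ^+ 2 <= (2 * B ^+ 2)%:E + 2%:E * x ^+ 2.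
  case: x => [r r0| _|//].
    rewrite -EFinD -!EFin_expe -EFinM -EFinD lee_fin.
    have := sqr_ge0 (B - r)%R; rewrite sqrrB sqrrD; lra.
  by rewrite addey// !expe2 !mulyy gt0_muley ?lte_fin// addey// leey.
apply: (@le_trans _ _ (\int[mu]_(x in `]0%R, t[)
    ((2 * B ^+ 2)%:E + 2%:E * rearrangement h x ^+ 2))).
  apply: ge0_le_integral => //.
  - by move=> x _; exact: sqr_rearrangement_ge0.
  - exact: measurable_rearrangement2.
  - apply: emeasurable_funD => //; apply: emeasurable_funM => //.
    exact: measurable_rearrangement2.
  - move=> x _; apply: le_trans (sqD _ (rearrangement_ge0 _ _)).
    rewrite !expe2; apply: lee_pmul; rewrite ?rearrangement_ge0//;
    exact: rearrangement_le_add.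
have h20 x : 0 <= 2%:E * rearrangement h x ^+ 2.
  by rewrite mule_ge0 ?sqr_rearrangement_ge0.
rewrite ge0_integralD//; first last.
- by apply: emeasurable_funM => //; exact: measurable_rearrangement2.
- by move=> x _; rewrite lee_fin mulr_ge0// sqr_ge0.
apply: leeD.
  have muI : mu `]0%R, t[%classic = t%:E.
    rewrite lebesgue_measure_itv/= lte_fin; case: ltgtP t0 => // [t0 _|<- _//].
    by rewrite oppr0 adde0.
  rewrite integral_cst// [X in _ * X](_ : _ = t%:E)//; exact: muI.
rewrite ge0_integralZl//; first last.
- by move=> x _; exact: sqr_rearrangement_ge0.
- exact: measurable_rearrangement2.
by apply: lee_wpmul2l => //; exact: integral_rearrangement_le.
Qed.

End rearrangement_L2.

(** * Finite orthonormal sums *)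

Section cvg_ereal0.
Context {R : realType} {T : Type} (F : set_system T) {FF : Filter F}.
Local Open Scope ereal_scope.

Lemma cvge0_le (f : T -> \bar R) : f x @[x --> F] --> 0 ->
  forall e : R, (0 < e)%R -> \forall x \near F, f x <= e%:E.
Proof.
move=> f0 e e0.
have h : nbhs (0 : \bar R) [set y | y < e%:E].
  by have := @nbhs_open_ereal_lt R 0%R (cst e) e0.
suff : F [set x | f x < e%:E] by apply: filterS => x /=; exact: ltW.
exact: (f0 _ h).
Qed.

Lemma cvge0 (f : T -> \bar R) : (forall x, 0 <= f x) ->
  (forall e : R, (0 < e)%R -> \forall x \near F, f x <= e%:E) ->
  f x @[x --> F] --> 0.
Proof.
move=> f0 fe A /= [d /= d0 dA].
have d20 : (0 < d / 2)%R by rewrite divr_gt0.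
suff : F [set x | f x <= (d / 2)%:E] -> F [set x | A (f x)] by apply; exact: fe.
apply: filterS => x /=; case: (f x) (f0 x) => [r| |]//=.
rewrite !lee_fin => r0 rd; apply: dA; rewrite /ball_/= sub0r normrN ger0_norm//.
by apply: le_lt_trans rd _; rewrite ltr_pdivrMr// ltr_pMr// ltr1n.
Qed.

End cvg_ereal0.

Section complex_facts.
Context {R : rcfType}.
Implicit Types (z w : R[i]) (a : R).
Local Notation normc := Normc.normc.

Lemma complex_ReD z w : complex.Re (z + w) = complex.Re z + complex.Re w.
Proof. by case: z w => [a b] [c d]. Qed.

Lemma complex_ImD z w : complex.Im (z + w) = complex.Im z + complex.Im w.
Proof. by case: z w => [a b] [c d]. Qed.

Lemma complex_ReM z w :
  complex.Re (z * w) = complex.Re z * complex.Re w - complex.Im z * complex.Im w.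
Proof. by case: z w => [a b] [c d]. Qed.

Lemma complex_ImM z w :
  complex.Im (z * w) = complex.Re z * complex.Im w + complex.Im z * complex.Re w.
Proof. by case: z w => [a b] [c d]. Qed.

Lemma complex_Reconj z : complex.Re (conjc z) = complex.Re z.
Proof. by case: z. Qed.

Lemma complex_Imconj z : complex.Im (conjc z) = - complex.Im z.
Proof. by case: z. Qed.

Lemma normc_mulconj z : z * conjc z = Complex (normc z ^+ 2) 0.
Proof.
case: z => [a b] /=; rewrite sqr_sqrtr ?addr_ge0 ?sqr_ge0//.
by apply/eqP; rewrite eq_complex/=; apply/andP; split; apply/eqP; ring.
Qed.

Lemma sqr_normcD_le z w : normc (z + w) ^+ 2 <= 2 * normc z ^+ 2 + 2 * normc w ^+ 2.
Proof.
case: z w => [a b] [c d] /=.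
rewrite !sqr_sqrtr ?addr_ge0 ?sqr_ge0//.
have := sqr_ge0 (a - c); have := sqr_ge0 (b - d); rewrite !sqrrB !sqrrD; lra.
Qed.

Lemma Re_le_normc z : `|complex.Re z| <= normc z.
Proof.
case: z => a b /=; rewrite -sqrtr_sqr ler_sqrt ?addr_ge0 ?sqr_ge0//.
by rewrite lerDl sqr_ge0.
Qed.

Lemma Im_le_normc z : `|complex.Im z| <= normc z.
Proof.
case: z => a b /=; rewrite -sqrtr_sqr ler_sqrt ?addr_ge0 ?sqr_ge0//.
by rewrite lerDr sqr_ge0.
Qed.

End complex_facts.

(** * Complex integrals, energies and orthogonality *)

Section cintegral.
Context {R : realType}.
Implicit Types (f g : R -> R[i]).
Local Notation mu := (@lebesgue_measure R).
Local Notation normc := Normc.normc.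
Local Notation I01 := (`[0%R, 1%R]%classic : set R).

Definition cintegrable f :=
  mu.-integrable I01 (EFin \o (fun x => complex.Re (f x))) /\
  mu.-integrable I01 (EFin \o (fun x => complex.Im (f x))).

Let mI01 : measurable I01. Proof. exact: measurable_itv. Qed.

Let fun_ReD (f g : R -> R[i]) : (fun x => complex.Re (f x + g x)) =
  (fun x => complex.Re (f x) + complex.Re (g x)).
Proof. by apply/funext => x; rewrite complex_ReD. Qed.

Let fun_ImD (f g : R -> R[i]) : (fun x => complex.Im (f x + g x)) =
  (fun x => complex.Im (f x) + complex.Im (g x)).
Proof. by apply/funext => x; rewrite complex_ImD. Qed.

Let fun_ReM (f g : R -> R[i]) : (fun x => complex.Re (f x * g x)) =
  (fun x => complex.Re (f x) * complex.Re (g x) - complex.Im (f x) * complex.Im (g x)).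
Proof. by apply/funext => x; rewrite complex_ReM. Qed.

Let fun_ImM (f g : R -> R[i]) : (fun x => complex.Im (f x * g x)) =
  (fun x => complex.Re (f x) * complex.Im (g x) + complex.Im (f x) * complex.Re (g x)).
Proof. by apply/funext => x; rewrite complex_ImM. Qed.

Lemma integrable_EFinD (a b : R -> R) : mu.-integrable I01 (EFin \o a) ->
  mu.-integrable I01 (EFin \o b) -> mu.-integrable I01 (EFin \o (fun x => a x + b x)).
Proof.
move=> ia ib; rewrite (_ : EFin \o _ = (EFin \o a) \+ (EFin \o b))%E.
  exact: integrableD.
by apply/funext => x /=; rewrite EFinD.
Qed.

Lemma integrable_EFinZ (k : R) (a : R -> R) : mu.-integrable I01 (EFin \o a) ->
  mu.-integrable I01 (EFin \o (fun x => k * a x)).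
Proof.
move=> ia; rewrite (_ : EFin \o _ = fun x => k%:E * (EFin \o a) x)%E.
  exact: integrableZl.
by apply/funext => x /=; rewrite EFinM.
Qed.

Lemma integrable_EFinB (a b : R -> R) : mu.-integrable I01 (EFin \o a) ->
  mu.-integrable I01 (EFin \o b) -> mu.-integrable I01 (EFin \o (fun x => a x - b x)).
Proof.
move=> ia ib; apply: integrable_EFinD => //.
under [fun x => - b x]eq_fun do rewrite -mulN1r.
exact: integrable_EFinZ.
Qed.

Lemma cintegrableD f g : cintegrable f -> cintegrable g ->
  cintegrable (fun x => f x + g x).
Proof.
move=> [f1 f2] [g1 g2]; split.
  rewrite fun_ReD.
  exact: integrable_EFinD.
rewrite fun_ImD.
  exact: integrable_EFinD.
Qed.

Lemma cintegralD f g : cintegrable f -> cintegrable g ->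
  cintegral (fun x => f x + g x) = cintegral f + cintegral g.
Proof.
move=> [f1 f2] [g1 g2]; rewrite /cintegral /GRing.add /=; congr Complex.
  by rewrite -RintegralD//; apply: eq_Rintegral => x _; rewrite complex_ReD.
by rewrite -RintegralD//; apply: eq_Rintegral => x _; rewrite complex_ImD.
Qed.

Lemma cintegrableZ (a : R[i]) f : cintegrable f -> cintegrable (fun x => a * f x).
Proof.
move=> [f1 f2]; split.
  rewrite fun_ReM.
  by apply: integrable_EFinB; exact: integrable_EFinZ.
rewrite fun_ImM.
by apply: integrable_EFinD; exact: integrable_EFinZ.
Qed.

Lemma cintegralZ (a : R[i]) f : cintegrable f ->
  cintegral (fun x => a * f x) = a * cintegral f.
Proof.
move=> [f1 f2]; apply/eqP; rewrite eq_complex; apply/andP; split; apply/eqP.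
  rewrite complex_ReM/= -!RintegralZl// -RintegralB//.
  - by apply: eq_Rintegral => x _; rewrite complex_ReM.
  - exact: integrable_EFinZ.
  - exact: integrable_EFinZ.
rewrite complex_ImM/= -!RintegralZl// -RintegralD//.
- by apply: eq_Rintegral => x _; rewrite complex_ImM.
- exact: integrable_EFinZ.
- exact: integrable_EFinZ.
Qed.

Lemma cintegral_sum (I : Type) (s : seq I) (F : I -> R -> R[i]) :
  (forall i, cintegrable (F i)) ->
  cintegrable (fun x => \sum_(i <- s) F i x) /\
  cintegral (fun x => \sum_(i <- s) F i x) = \sum_(i <- s) cintegral (F i).
Proof.
move=> iF; elim: s => [|i s [IH1 IH2]].
  rewrite big_nil; under eq_fun do rewrite big_nil; split.
    by split; exact: integrable0.
  by rewrite /cintegral /= !Rintegral_cst// !mul0r.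
rewrite big_cons -IH2 -cintegralD//.
under eq_fun do rewrite big_cons; split => //; exact: cintegrableD.
Qed.

Lemma energy_integrable f : cmeasurable f -> (energy f < +oo)%E ->
  mu.-integrable I01 (EFin \o (fun x => normc (f x) ^+ 2)).
Proof.
move=> mf ef; apply/integrableP; split.
  by apply/measurable_EFinP; exact: cmeasurable_sqr_normc.
by under eq_integral do rewrite /= ger0_norm ?sqr_ge0//.
Qed.

Lemma cmeasurableM f g : cmeasurable f -> cmeasurable g ->
  cmeasurable (fun x => f x * g x).
Proof.
move=> [f1 f2] [g1 g2]; split.
  rewrite fun_ReM.
  by apply: measurable_funB; apply: measurable_funM.
rewrite fun_ImM.
by apply: measurable_funD; apply: measurable_funM.
Qed.

Lemma cmeasurable_conj f : cmeasurable f -> cmeasurable (fun x => conjc (f x)).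
Proof.
move=> [f1 f2]; split.
  rewrite (_ : (fun x => _) = (fun x => complex.Re (f x)))//.
  by apply/funext => x; rewrite complex_Reconj.
rewrite (_ : (fun x => _) = (fun x => - complex.Im (f x))).
  exact: measurable_funN.
by apply/funext => x; rewrite complex_Imconj.
Qed.

Lemma cmeasurableD f g : cmeasurable f -> cmeasurable g ->
  cmeasurable (fun x => f x + g x).
Proof.
move=> [f1 f2] [g1 g2]; split.
  by rewrite fun_ReD; apply: measurable_funD.
by rewrite fun_ImD; apply: measurable_funD.
Qed.

Lemma cmeasurableZ (a : R[i]) f : cmeasurable f -> cmeasurable (fun x => a * f x).
Proof. by apply: cmeasurableM; split; exact: measurable_cst. Qed.

Lemma cmeasurableB f g : cmeasurable f -> cmeasurable g ->
  cmeasurable (fun x => f x - g x).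
Proof.
move=> mf mg; apply: cmeasurableD => //.
by under eq_fun do rewrite -mulN1r; exact: cmeasurableZ.
Qed.

Lemma cintegrable_mulconj f g : cmeasurable f -> cmeasurable g ->
  (energy f < +oo)%E -> (energy g < +oo)%E ->
  cintegrable (fun x => f x * conjc (g x)).
Proof.
move=> mf mg ef eg.
have [m1 m2] := cmeasurableM mf (cmeasurable_conj mg).
(* The dominating function is |f|^2 + |g|^2; each sign case below is a combination of squares of
   sums and differences. *)
have ifg := integrable_EFinD (energy_integrable mf ef) (energy_integrable mg eg).
split; apply: le_integrable ifg => //; try exact/measurable_EFinP;
  move=> x _ /=; rewrite lee_fin [leRHS]ger0_norm ?addr_ge0 ?sqr_ge0//;
  move: (f x) (g x) => [a b] [c d] /=;
  rewrite !sqr_sqrtr ?addr_ge0 ?sqr_ge0// ler_norml; apply/andP; split.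
- by have := sqr_ge0 (a + c); have := sqr_ge0 (b + d); rewrite !sqrrD; have := sqr_ge0 (a - c); have := sqr_ge0 (b - d); rewrite !sqrrB; lra.
- by have := sqr_ge0 (a + c); have := sqr_ge0 (b + d); rewrite !sqrrD; have := sqr_ge0 (a - c); have := sqr_ge0 (b - d); rewrite !sqrrB; lra.
- by have := sqr_ge0 (a + d); have := sqr_ge0 (b + c); rewrite !sqrrD; have := sqr_ge0 (a - d); have := sqr_ge0 (b - c); rewrite !sqrrB; lra.
- by have := sqr_ge0 (a + d); have := sqr_ge0 (b + c); rewrite !sqrrD; have := sqr_ge0 (a - d); have := sqr_ge0 (b - c); rewrite !sqrrB; lra.
Qed.

Lemma energyE f : cmeasurable f -> (energy f < +oo)%E ->
  energy f = (complex.Re (inner f f))%:E.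
Proof.
move=> mf ef; rewrite /inner /cintegral/= /energy.
rewrite -[LHS]fineK; last first.
  by rewrite ge0_fin_numE// integral_ge0// => x _; rewrite lee_fin sqr_ge0.
congr (_%:E); apply: eq_Rintegral => x _ /=.
by rewrite normc_mulconj.
Qed.

End cintegral.

Section L2.
Context {R : realType}.
Implicit Types (f g : R -> R[i]).
Local Notation mu := (@lebesgue_measure R).
Local Notation normc := Normc.normc.
Local Open Scope ereal_scope.

Lemma Lnorm01_2E f : Lnorm01 2%:E f = energy f `^ 2^-1.
Proof.
rewrite /Lnorm01 unlock /energy; congr (_ `^ _).
rewrite [RHS]integral_mkcond; apply: eq_integral => x _; rewrite !patchE.
case: ifPn => _ /=; last by rewrite normr0 powR0.
by rewrite ger0_norm ?normc_ge0// powR_mulrn// normc_ge0.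
Qed.

Lemma energyE_Lnorm f : energy f = Lnorm01 2%:E f `^ 2.
Proof. by rewrite Lnorm01_2E -poweRrM mulVf// poweRe1// energy_ge0. Qed.

Lemma inL2E f : inL2 f <-> cmeasurable f /\ energy f < +oo.
Proof.
split=> -[mf f2]; split => //; first by rewrite energyE_Lnorm poweR_lty.
by rewrite Lnorm01_2E poweR_lty.
Qed.

Lemma energyD_le f g : cmeasurable f -> cmeasurable g ->
  energy (fun x => f x + g x)%R <= 2%:E * energy f + 2%:E * energy g.
Proof.
move=> mf mg; have m01 : measurable (`[0%R, 1%R]%classic : set R).
  exact: measurable_itv.
have mf2 : measurable_fun (`[0%R, 1%R]%classic : set R)
    (fun x => (normc (f x) ^+ 2)%:E).
  by apply/measurable_EFinP; exact: cmeasurable_sqr_normc.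
have mg2 : measurable_fun (`[0%R, 1%R]%classic : set R)
    (fun x => (normc (g x) ^+ 2)%:E).
  by apply/measurable_EFinP; exact: cmeasurable_sqr_normc.
rewrite /energy -!ge0_integralZl//; try by move=> x _; rewrite lee_fin sqr_ge0.
rewrite -ge0_integralD//; first last.
- exact: emeasurable_funM.
- by move=> x _; rewrite lee_fin mulr_ge0// sqr_ge0.
- exact: emeasurable_funM.
- by move=> x _; rewrite lee_fin mulr_ge0// sqr_ge0.
apply: ge0_le_integral => //.
- by move=> x _; rewrite lee_fin sqr_ge0.
- by apply/measurable_EFinP; apply: cmeasurable_sqr_normc; exact: cmeasurableD.
- by apply: emeasurable_funD; exact: emeasurable_funM.
- by move=> x _; rewrite -!EFinM -EFinD lee_fin sqr_normcD_le.
Qed.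

Lemma inL2D f g : inL2 f -> inL2 g -> inL2 (fun x => f x + g x)%R.
Proof.
rewrite !inL2E => -[mf ef] [mg eg]; split; first exact: cmeasurableD.
by apply: le_lt_trans (energyD_le mf mg) _; rewrite lte_add_pinfty// lte_mul_pinfty.
Qed.

Lemma energyZ (a : R[i]) f : cmeasurable f ->
  energy (fun x => a * f x)%R = (normc a ^+ 2)%:E * energy f.
Proof.
move=> mf; rewrite /energy -ge0_integralZl//.
- by apply: eq_integral => x _; rewrite Normc.normcM exprMn.
- by apply/measurable_EFinP; exact: cmeasurable_sqr_normc.
- by move=> x _; rewrite lee_fin sqr_ge0.
- by rewrite lee_fin sqr_ge0.
Qed.

Lemma inL2Z (a : R[i]) f : inL2 f -> inL2 (fun x => a * f x)%R.
Proof.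
rewrite !inL2E => -[mf ef]; split; first exact: cmeasurableZ.
by rewrite energyZ// lte_mul_pinfty// lee_fin sqr_ge0.
Qed.

Lemma inL2B (g h : R -> R[i]) : inL2 g -> inL2 h -> inL2 (fun x => g x - h x)%R.
Proof.
move=> g2 h2; apply: inL2D => //.
rewrite (_ : (fun x => _) = (fun x => -1 * h x))%R; first exact: inL2Z.
by apply/funext => x; rewrite mulN1r.
Qed.

Lemma inL2_sum (I : Type) (s : seq I) (F : I -> R -> R[i]) :
  (forall i, inL2 (F i)) -> inL2 (fun x => \sum_(i <- s) F i x)%R.
Proof.
move=> mF; elim: s => [|i s IH].
  under eq_fun do rewrite big_nil; apply/inL2E; split.
    by split; exact: measurable_cst.
  by rewrite /energy; under eq_integral do rewrite Normc.normc0 expr0n/=;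
    rewrite integral0.
by under eq_fun do rewrite big_cons; exact: inL2D.
Qed.

Lemma energy_orthonormal_sum (I : eqType) (phi : I -> R -> R[i]) (c : I -> R[i])
  (s : seq I) : orthonormal_system phi -> uniq s ->
  energy (fun x => \sum_(i <- s) c i * phi i x)%R =
  (\sum_(i <- s) normc (c i) ^+ 2)%:E.
Proof.
move=> [phi2 phio] us.
have sL2 : inL2 (fun x => \sum_(i <- s) c i * phi i x)%R.
  by apply: inL2_sum => i; exact: inL2Z.
have /inL2E[ms es] := sL2.
have ip i j : cintegrable (fun x => phi i x * conjc (phi j x))%R.
  by have /inL2E[? ?] := phi2 i; have /inL2E[? ?] := phi2 j;
    exact: cintegrable_mulconj.
rewrite energyE//; congr (_%:E).
suff -> : inner (fun x => \sum_(i <- s) c i * phi i x)%R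
    (fun x => \sum_(i <- s) c i * phi i x)%R =
    (\sum_(i <- s) (c i * conjc (c i)))%R.
  elim: (s) => [|i t IH]; first by rewrite !big_nil.
  by rewrite !big_cons complex_ReD IH normc_mulconj.
rewrite /inner.
transitivity (cintegral (fun x => \sum_(i <- s) c i *
    (\sum_(j <- s) conjc (c j) * (phi i x * conjc (phi j x))))%R).
  congr cintegral; apply/funext => x; rewrite mulr_suml; apply: eq_bigr => i _.
  rewrite rmorph_sum mulr_sumr mulr_sumr; apply: eq_bigr => j _.
  by rewrite rmorphM; ring.
have ipj i j : cintegrable (fun x => conjc (c j) * (phi i x * conjc (phi j x)))%R.
  exact: cintegrableZ.
have ipi i : cintegrable (fun x => \sum_(j <- s) conjc (c j) * (phi i x * conjc (phi j x)))%R.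
  by have [] := cintegral_sum s (ipj i).
have [_ ->] := cintegral_sum s (fun i => cintegrableZ (c i) (ipi i)).
rewrite big_seq [RHS]big_seq; apply: eq_bigr => i si.
rewrite cintegralZ//; congr (_ * _)%R.
have [_ ->] := cintegral_sum s (ipj i).
rewrite (bigD1_seq i)//= cintegralZ// [cintegral _]phio eqxx mulr1 big1 ?addr0// => j ji.
by rewrite cintegralZ// [cintegral _]phio eq_sym (negbTE ji) mulr0.
Qed.

End L2.

(** * Largest coefficients *)

Lemma term_le_nneseries {R : realType} (u : nat -> \bar R) m i :
  (forall j, 0 <= u j)%E -> (m <= i)%N -> (u i <= \sum_(m <= j <oo) u j)%E.
Proof.
move=> u0 mi; apply: (@le_trans _ _ (\sum_(m <= j < i.+1) u j)%E); last first.
  by apply: nneseries_lim_ge => j _ _; exact: u0.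
by rewrite big_nat_recr//=; apply: leeDr; apply: sume_ge0 => j _; exact: u0.
Qed.

Section seq_rearrangement.
Context {R : realType} {I : choiceType}.
Implicit Types (c : I -> R[i]) (s t : seq I).
Local Notation normc := Normc.normc.
Local Open Scope ereal_scope.

Lemma seq_rearrangement_ge0 c k : 0 <= seq_rearrangement c k.
Proof. by apply/ereal_infP => _ [s [s0 _] <-]; rewrite lee_fin. Qed.

Lemma le_seq_rearrangement c c' k : (forall n, normc (c' n) <= normc (c n))%R ->
  seq_rearrangement c' k <= seq_rearrangement c k.
Proof.
move=> cc; apply: ereal_inf_le_tmp => _ [s [s0 sk] <-]; exists s => //; split => //.
by apply: card_le_trans sk; apply: subset_card_le => n /= /lt_le_trans; apply.
Qed.

Lemma le_sup_seq_rearrangement c (a : R) k : (0 <= a)%R ->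
  (forall n, normc (c n) <= a)%R -> seq_rearrangement c k <= a%:E.
Proof.
move=> a0 ca; apply: ereal_inf_lbound; exists a => //; split => //.
rewrite (_ : [set n | _] = set0) ?card_ge0//.
by apply/seteqP; split => // n /=; rewrite ltNge ca.
Qed.

(** Pigeonhole: a level a < v admissible at rank [size t] would have [size t] indices above it, one
    more than allowed. *)
Lemma seq_rearrangement_ge c t (v : R) : uniq t -> (0 < size t)%N ->
  (forall x, x \in t -> v <= normc (c x))%R ->
  v%:E <= seq_rearrangement c (size t).
Proof.
move=> ut st tv; apply/ereal_infP => _ [a [a0 ak] <-]; rewrite lee_fin leNgt.
apply/negP => av.
have h : (`I_(size t) #<= [set n | (a < normc (c n))%R])%card.
  have [x0 _] : exists x0, x0 \in t by case: (t) st => // x l _; exists x; rewrite inE eqxx.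
  have inj : {in `I_(size t) &, injective (nth x0 t)}.
    by move=> i j; rewrite !inE/= => it jt /eqP; rewrite nth_uniq// => /eqP.
  have /card_eqPle[_ /card_le_trans] := inj_card_eq inj; apply.
  apply: subset_card_le => _ [i /= it <-].
  by rewrite (lt_le_trans av)// tv// mem_nth.
have := card_le_trans h ak; rewrite card_le_II.
by case: (size t) st => // n _ /=; rewrite ltnn.
Qed.

Section square_summable.
Variable c : I -> R[i].
Hypothesis c2 : \sum_(1 <= i <oo) seq_rearrangement c i ^+ 2 < +oo.

Let sq_ge0 i : 0 <= seq_rearrangement c i ^+ 2.
Proof. by rewrite expe_ge0// seq_rearrangement_ge0. Qed.

Lemma seq_rearrangement_fin i : (0 < i)%N -> seq_rearrangement c i \is a fin_num.
Proof.
move=> i0; rewrite ge0_fin_numE ?seq_rearrangement_ge0// ltNge leye_eq.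
apply/negP => /eqP ci; have := le_lt_trans (term_le_nneseries sq_ge0 i0) c2.
by rewrite ci expe2 mulyy ltxx.
Qed.

(** Either some rank k has its rearranged value below a, and then fewer than k indices lie above a;
    or all values are at least a, and n a^2 would stay below the finite square sum for every n. *)
Lemma finite_superlevel (a : R) : (0 < a)%R ->
  finite_set [set n | (a < normc (c n))%R].
Proof.
move=> a0.
have [[k k0 ka]|na] := pselect (exists2 k, (0 < k)%N & seq_rearrangement c k < a%:E).
  have [_ [s [s0 sk] <-]] := ereal_inf_lt ka.
  rewrite lte_fin => sa; apply: (@sub_finite_set _ _ [set n | (s < normc (c n))%R]).
    by move=> n /=; exact: lt_trans.
  by apply/finite_set_leP; exists k.-1.
exfalso; move: c2; rewrite -ge0_fin_numE; last first.
  by apply: nneseries_ge0 => j _ _; exact: sq_ge0.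
move=> /fineK; set X := fine _ => XE.
have h n : (n%:R * a ^+ 2 <= X)%R.
  rewrite -lee_fin XE.
  apply: (@le_trans _ _ (\sum_(1 <= j < n.+1) seq_rearrangement c j ^+ 2)); last first.
    by apply: nneseries_lim_ge => j _ _; exact: sq_ge0.
  apply: (@le_trans _ _ (\sum_(1 <= j < n.+1) (a ^+ 2)%:E)).
    by rewrite sumEFin big_const_nat iter_addr addr0 subSS subn0 lee_fin mulr_natl.
  rewrite big_nat [leRHS]big_nat; apply: lee_sum => j /andP[j1 _].
  rewrite EFin_expe !expe2.
  have aj : a%:E <= seq_rearrangement c j.
    by rewrite leNgt; apply/negP => ja; apply: na; exists j.
  by apply: lee_pmul; rewrite ?lee_fin// ltW.
have a20 : (0 < a ^+ 2)%R by rewrite exprn_gt0.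
have X0 : (0 <= X / a ^+ 2)%R.
  by rewrite divr_ge0 ?(ltW a20)//; have := h 0%N; rewrite mul0r.
have := h (Num.truncn (X / a ^+ 2)).+1; rewrite leNgt => /negP; apply.
rewrite -ltr_pdivrMr//; by have /andP[] := truncn_itv X0.
Qed.

Lemma seq_argmax (f : I -> R) t : t != [::] ->
  exists2 x, x \in t & forall y, y \in t -> (f y <= f x)%R.
Proof.
elim: t => // a [|b t] IH _.
  by exists a; rewrite ?inE// => y; rewrite inE => /eqP ->.
have [//|x xt xm] := IH.
have [ax|xa] := leP (f a) (f x).
  exists x; first by rewrite in_cons xt orbT.
  by move=> y; rewrite inE => /predU1P[->//|/xm].
exists a; rewrite ?mem_head// => y; rewrite inE => /predU1P[->//|/xm /le_trans->//].
exact: ltW.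
Qed.

(** A maximiser of |c| outside A exists because only finitely many coefficients exceed a given
    positive level. When every coefficient outside A vanishes there is no such level and the
    selection stops early, hence the last alternative. *)
Lemma greedy N : exists A : seq I, [/\ uniq A, (size A <= N)%N,
  forall n m, n \notin A -> m \in A -> (normc (c n) <= normc (c m))%R &
  size A = N \/ forall n, n \notin A -> c n = 0%R].
Proof.
elim: N => [|N [A [uA sA gA AN]]]; first by exists [::]; split => //; left.
have [nA|] := pselect (forall n, n \notin A -> c n = 0%R).
  by exists A; split => //; [exact: leqW|right].
move=> /existsNP[n0 /not_implyP[n0A cn0]].
case: AN => [AN|/(_ _ n0A)//].
have v0 : (0 < normc (c n0))%R.
  rewrite lt_neqAle normc_ge0 andbT eq_sym; apply/eqP => /Normc.eq0_normc//.
(* Half of |c n0| is a strictly smaller level, so [n0] itself belongs to the finite list and the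
   maximum is taken over a nonempty one. *)
have v20 : (0 < normc (c n0) / 2)%R by rewrite divr_gt0.
have [t tE] := (finite_seqP _).1 (finite_superlevel v20).
have memt n : (normc (c n0) / 2 < normc (c n))%R = (n \in t).
  by have := congr1 (fun S => S n) tE; rewrite /= propeqE => h; apply/idP/idP => /h.
have n0t : n0 \in [seq n <- t | n \notin A].
  rewrite mem_filter n0A -memt ltr_pdivrMr// ltr_pMr// ltr1n//.
have [|x] := @seq_argmax (fun n => normc (c n)) [seq n <- t | n \notin A].
  by apply/eqP => h; rewrite h in n0t.
rewrite mem_filter => /andP[xA xt] xm.
have xmax n : n \notin A -> (normc (c n) <= normc (c x))%R.
  move=> nA; have [nt|nt] := boolP (n \in t).
    by apply: xm; rewrite mem_filter nA.
  move: nt; rewrite -memt -leNgt => /le_trans; apply.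
  apply: le_trans (xm _ n0t).
  by rewrite ler_pdivrMr// ler_peMr ?normc_ge0// ler1n.
exists (x :: A); split => /=.
- by rewrite xA.
- by rewrite ltnS.
- move=> n m; rewrite !inE negb_or => /andP[nx nA] /predU1P[->|mA].
    exact: xmax.
  exact: gA.
- by left; rewrite AN.
Qed.

Let r i : R := fine (seq_rearrangement c i).

Let desc (x y : I) := (normc (c y) <= normc (c x))%R.

Lemma sorted_desc_le (x0 : I) t i j : (i <= j)%N -> (j < size t)%N ->
  (normc (c (nth x0 (sort desc t) j)) <= normc (c (nth x0 (sort desc t) i)))%R.
Proof.
move=> ij jt.
have tr : transitive desc by move=> y x z xy yz; exact: le_trans yz xy.
have rf : reflexive desc by move=> x; exact: lexx.
have to : total desc by move=> x y; rewrite /desc le_total.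
apply: (@sorted_leq_nth _ desc tr rf x0 (sort desc t)) => //.
- exact: sort_sorted.
- by rewrite inE size_sort (leq_ltn_trans ij).
- by rewrite inE size_sort.
Qed.

Lemma sum_nth_sort (x0 : I) t (F : I -> R) :
  (\sum_(i <- t) F i = \sum_(j < size t) F (nth x0 (sort desc t) j))%R.
Proof.
transitivity (\sum_(i <- sort desc t) F i)%R.
  by apply: perm_big; rewrite perm_sym; apply/permPl; exact: perm_sort.
by rewrite (big_nth x0) size_sort big_mkord.
Qed.

(** A and the j + 1 largest entries of t form size A + j + 1 distinct indices where |c| is at least
    the value in question, so [seq_rearrangement_ge] applies at that rank. *)
Lemma nth_sort_le A t (x0 : I) j : uniq A -> uniq t -> (forall x, x \in t -> x \notin A) ->
  (forall n m, n \notin A -> m \in A -> (normc (c n) <= normc (c m))%R) ->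
  (j < size t)%N ->
  (normc (c (nth x0 (sort desc t) j)) <= r (size A + j).+1)%R.
Proof.
move=> uA ut tA gA jt.
rewrite -lee_fin fineK; last exact: seq_rearrangement_fin.
pose u := A ++ take j.+1 (sort desc t).
have su : size u = (size A + j).+1.
  by rewrite size_cat size_takel ?size_sort ?addnS.
have mt x : x \in take j.+1 (sort desc t) -> x \in t.
  by move=> /mem_take; rewrite mem_sort.
rewrite -su; apply: seq_rearrangement_ge.
- rewrite cat_uniq uA take_uniq ?sort_uniq// andbT/=.
  by apply/hasPn => x /mt /tA.
- by rewrite su.
move=> x; rewrite mem_cat => /orP[xA|].
  by apply: gA => //; apply: tA; rewrite -(mem_sort desc) mem_nth// size_sort.
case/(nthP x0) => i; rewrite size_takel ?size_sort// => ij <-.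
by rewrite nth_take//; apply: sorted_desc_le.
Qed.

Lemma sum_sqr_le_tail A B : uniq A -> uniq B ->
  (forall x, x \in B -> x \notin A) ->
  (forall n m, n \notin A -> m \in A -> (normc (c n) <= normc (c m))%R) ->
  (\sum_(n <- B) normc (c n) ^+ 2)%:E <=
  \sum_((size A).+1 <= i <oo) seq_rearrangement c i ^+ 2.
Proof.
case: B => [|x0 B'] uA uB BA gA.
  by rewrite big_nil nneseries_ge0.
set B := x0 :: B' in uB BA *.
rewrite (sum_nth_sort x0); set N := size A.
apply: (@le_trans _ _ (\sum_(N.+1 <= i < N.+1 + size B) seq_rearrangement c i ^+ 2)).
  rewrite -{1}[N.+1]add0n big_addn addKn big_mkord -sumEFin.
  apply: lee_sum => j _.
  have := @nth_sort_le A B x0 j uA uB BA gA (ltn_ord j).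
  rewrite addnC -addnS -lee_fin fineK ?seq_rearrangement_fin ?addnS// => h.
  rewrite EFin_expe !expe2.
  by apply: lee_pmul; rewrite ?lee_fin ?normc_ge0.
by apply: nneseries_lim_ge => j _ _; exact: sq_ge0.
Qed.

Lemma sum_sqr_le B : uniq B ->
  (\sum_(n <- B) normc (c n) ^+ 2)%:E <=
  \sum_(1 <= i <oo) seq_rearrangement c i ^+ 2.
Proof. by move=> uB; exact: (@sum_sqr_le_tail [::]). Qed.

(** The remainder is tested on finite lists B because f minus its sum over A is only reached through
    finite windows, in [energy_remainder_le]. *)
Lemma best_approximation N : exists A : seq I, [/\ uniq A,
  (\sum_(n <- A) normc (c n) <= \sum_(1 <= i < N.+1) r i)%R &
  forall B : seq I, uniq B -> (forall x, x \in B -> x \notin A) ->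
    (\sum_(n <- B) normc (c n) ^+ 2)%:E <=
    \sum_(N.+1 <= i <oo) seq_rearrangement c i ^+ 2].
Proof.
have [A [uA sA gA AN]] := greedy N.
exists A; split => //.
  case: A => [|x0 A'] in uA sA gA AN *.
    by rewrite big_nil sumr_ge0// => i _; rewrite fine_ge0// seq_rearrangement_ge0.
  set A := x0 :: A' in uA sA gA AN *.
  rewrite (sum_nth_sort x0).
  apply: (@le_trans _ _ (\sum_(j < size A) r j.+1)%R).
    apply: ler_sum => j _.
    by have := @nth_sort_le [::] A x0 j isT uA _ _ (ltn_ord j); rewrite add0n; apply.
  rewrite -(big_mkord xpredT (fun j => r j.+1)) [leRHS]big_add1/=.
  rewrite [leRHS](@big_cat_nat _ _ _ (size A))//= lerDl sumr_ge0// => i _.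
  by rewrite fine_ge0// seq_rearrangement_ge0.
move=> B uB BA.
case: AN => [AN|zA]; last first.
  rewrite big_seq big1 ?nneseries_ge0// => n nB.
  by rewrite (zA _ (BA _ nB)) Normc.normc0 expr0n.
by rewrite -AN; exact: sum_sqr_le_tail.
Qed.

End square_summable.
End seq_rearrangement.

Section window.
Variable k : index_kind.

Lemma window_uniq m n : uniq (window k m n).
Proof.
case: k => /=; first exact: iota_uniq.
by rewrite map_inj_uniq ?iota_uniq// => i j /addIr [].
Qed.

Lemma window_ge (x : index_type k) :
  exists N, forall m n, (N <= m)%N -> (N <= n)%N -> x \in window k m n.
Proof.
case: k x => /= x.
  by exists x.+1 => m n _ xn; rewrite mem_iota add0n.
exists `|x|.+1%N => m n xm xn; apply/mapP; exists `|(x + m%:Z)%R|%N.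
  by rewrite mem_iota add0n; lia.
by lia.
Qed.

Lemma window_near (A : seq (index_type k)) :
  \forall mn \near filter_prod \oo \oo, {subset A <= window k mn.1 mn.2}.
Proof.
have [N AN] : exists N, forall m n, (N <= m)%N -> (N <= n)%N ->
    {subset A <= window k m n}.
  elim: A => [|x A [N IH]]; first by exists 0%N.
  have [N' xN] := window_ge x; exists (maxn N N') => m n.
  rewrite !geq_max => /andP[Nm N'm] /andP[Nn N'n] y.
  by rewrite inE => /predU1P[->|]; [exact: xN|exact: IH].
exists ([set m | (N <= m)%N], [set n | (N <= n)%N]) => /=.
  by split; exists N.
by move=> [m n] [/= Nm Nn]; exact: AN.
Qed.

End window.

(** * Splitting f along its largest coefficients *)

Section system.
Context {R : realType} (k : index_kind) (phi : index_type k -> R -> R[i]) (M : R).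
Local Notation mu := (@lebesgue_measure R).
Local Notation normc := Normc.normc.
Hypothesis phio : orthonormal_system phi.
Hypothesis phiM :
  ereal_sup [set Lnorm01 +oo%E (phi n) | n in [set: index_type k]] = M%:E.

Local Open Scope ereal_scope.

Lemma system_bounded n :
  {ae mu, forall x, x \in `[0%R, 1%R] -> (normc (phi n x) <= M)%R}.
Proof.
have : Lnorm01 +oo (phi n) <= M%:E.
  by rewrite -phiM; apply: ereal_sup_ubound; exists n.
(* The norm at +oo is an essential supremum only when the whole space has positive measure, which is
   checked on the unit interval. *)
rewrite /Lnorm01 unlock; case: ifPn => [_|]; last first.
  rewrite -leNgt => mu0; exfalso; move: mu0; apply/negP; rewrite -ltNge.
  apply: (@lt_le_trans _ _ (mu `[0%R, 1%R]%classic)).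
    by rewrite lebesgue_measure_itv/= lte_fin ltr01 -EFinB subr0 lte_fin.
  by apply: le_measure; rewrite ?inE.
move=> /ess_supP; apply: filterS => x /= + x01.
by rewrite patchE ifT ?inE//= lee_fin ger0_norm// normc_ge0.
Qed.

Lemma energy_system n : energy (phi n) = 1.
Proof.
have := @energy_orthonormal_sum R _ phi (fun=> 1%R) [:: n] phio isT.
rewrite big_seq1 Normc.normc1 expr1n => <-; rewrite /energy.
by apply: eq_integral => x _; rewrite big_seq1 mul1r.
Qed.

(** On an interval of length 1 the L_2 norm, here 1, is at most the L_oo norm. *)
Lemma system_bound_ge1 : (1 <= M)%R.
Proof.
have [n _] : exists n : index_type k, True by case: k; exists 0%N || exists 0%R.
have M0 : (0 <= M)%R.
  rewrite -lee_fin -phiM; apply: (@le_trans _ _ (Lnorm01 +oo (phi n))).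
    exact: Lnorm_ge0.
  by apply: ereal_sup_ubound; exists n.
rewrite -(ler_pXn2r (ltn0Sn 1)) ?nnegrE// expr1n -lee_fin -(energy_system n).
have mn : cmeasurable (phi n) by have [/(_ n)[]] := phio.
apply: (@le_trans _ _ (\int[mu]_(x in `[0%R, 1%R]) (cst (M ^+ 2)%:E x))).
  apply: ae_ge0_le_integral => //.
  - by move=> x _; rewrite lee_fin sqr_ge0.
  - by apply/measurable_EFinP; exact: cmeasurable_sqr_normc.
  - by move=> x _; rewrite lee_fin sqr_ge0.
  have F : Filter (almost_everywhere mu) by exact: (ae_filter_ringOfSetsType mu).
  have := system_bounded n; apply: filterS => x /= h x01.
  by rewrite lee_fin ler_pXn2r ?nnegrE ?normc_ge0// h.
rewrite integral_cst//.
have mu1 : mu `[0%R, 1%R]%classic = 1.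
  by rewrite lebesgue_measure_itv/= lte_fin ltr01 -EFinB subr0.
by rewrite [X in _ * X](_ : _ = 1) ?mule1//; exact: mu1.
Qed.

Variables (c : index_type k -> R[i]) (f : R -> R[i]).
Hypothesis fc : is_sum c phi f.

Let psum (s : seq (index_type k)) : R -> R[i] := fun x => (\sum_(i <- s) c i * phi i x)%R.

Let psum_L2 s : inL2 (psum s).
Proof. by apply: inL2_sum => i; apply: inL2Z; case: phio. Qed.

(** A large window W contains A and makes f minus its window sum negligible; the part of W outside A
    is an orthonormal sum of energy at most T. The factor 2 is that of [energyD_le]. *)
Lemma energy_remainder_le (A : seq (index_type k)) (T : R) : uniq A ->
  (forall B, uniq B -> (forall x, x \in B -> x \notin A) ->
    \sum_(n <- B) normc (c n) ^+ 2 <= T)%R ->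
  energy (fun x => f x - \sum_(i <- A) c i * phi i x)%R <= (2 * T)%:E.
Proof.
move=> uA AT; have [f2 cvgf] := fc.
apply/lee_addgt0Pr => e e0.
have e20 : (0 < e / 2)%R by rewrite divr_gt0.
have se0 : (0 < Num.sqrt (e / 2))%R by rewrite sqrtr_gt0.
have FF : ProperFilter (filter_prod (\oo : set_system nat) (\oo : set_system nat)).
  exact: filter_prod_proper.
have h1 := @cvge0_le R _ _ FF _ cvgf _ se0.
have [[m n] [/= fmn Amn]] := filter_ex (filterI h1 (window_near A)).
set W := window k m n in Amn.
have fW : energy (fun x => f x - psum W x)%R <= (e / 2)%:E.
  rewrite energyE_Lnorm; apply: (@le_trans _ _ ((Num.sqrt (e / 2))%:E `^ 2)).
    apply: ge0_lee_poweR => //; exact: Lnorm_ge0.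
  by rewrite poweR_EFin powR_mulrn ?sqrtr_ge0// sqr_sqrtr// ltW.
pose B := [seq i <- W | i \notin A].
have uB : uniq B by rewrite filter_uniq// window_uniq.
have BA x : x \in B -> x \notin A by rewrite mem_filter => /andP[].
have WAB x : psum W x = (psum A x + psum B x)%R.
  rewrite /psum (bigID (mem A))/=; congr (_ + _)%R; last by rewrite big_filter.
  rewrite -big_filter; apply: perm_big; apply: uniq_perm => //.
    by rewrite filter_uniq// window_uniq.
  by move=> i; rewrite mem_filter/=; case: (boolP (i \in A)) => //= /Amn ->.
rewrite (_ : (fun x => _) = (fun x => (f x - psum W x) + psum B x))%R; last first.
  by apply/funext => x; rewrite WAB /psum; ring.
have [mfW _] := inL2B f2 (psum_L2 W); have [mB _] := psum_L2 B.
apply: (le_trans (energyD_le mfW mB)).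
rewrite (energy_orthonormal_sum c phio uB) -EFinM [leRHS]addeC.
apply: leeD; last by rewrite lee_fin ler_wpM2l// AT.
apply: (@le_trans _ _ (2%:E * (e / 2)%:E)); first exact: lee_wpmul2l.
by rewrite -EFinM lee_fin mulrC divfK.
Qed.

Hypothesis c2 : \sum_(1 <= i <oo) seq_rearrangement c i ^+ 2 < +oo.

(** The bounded part is the sum over the list of [best_approximation], controlled almost everywhere
    by M times a sum of moduli. The constant 4 is the product of the factors 2 of [primitive_le] and
    [energy_remainder_le]. *)
Lemma primitive_approximation N (t : R) : (0 <= t)%R ->
  \int[mu]_(x in `]0%R, t[) rearrangement f x ^+ 2 <=
  (2 * (M * \sum_(1 <= i < N.+1) fine (seq_rearrangement c i)) ^+ 2 * t +
   4 * fine (\sum_(N.+1 <= i <oo) seq_rearrangement c i ^+ 2))%:E.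
Proof.
move=> t0; have [A [uA sA BA]] := best_approximation c2 N.
have M0 : (0 <= M)%R by exact: le_trans system_bound_ge1.
have tail0 j : 0 <= \sum_(j <= i <oo) seq_rearrangement c i ^+ 2.
  by apply: nneseries_ge0 => i _ _; rewrite expe_ge0// seq_rearrangement_ge0.
have tailfin : \sum_(N.+1 <= i <oo) seq_rearrangement c i ^+ 2 \is a fin_num.
  rewrite ge0_fin_numE//; apply: le_lt_trans c2.
  rewrite (@nneseries_split _ _ 1 N); last first.
    by move=> i _; rewrite expe_ge0// seq_rearrangement_ge0.
  rewrite add1n leeDr// sume_ge0// => i _.
  by rewrite expe_ge0// seq_rearrangement_ge0.
set T := fine _.
have energyh : energy (fun x => f x - psum A x)%R <= (2 * T)%:E.
  apply: energy_remainder_le => // B uB /(BA _ uB).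
  by rewrite -lee_fin fineK.
have [f2 _] := fc; have [mf _] := f2; have [mh _] := inL2B f2 (psum_L2 A).
set S := (\sum_(1 <= i < _) _)%R in sA *.
have S0 : (0 <= S)%R.
  by rewrite sumr_ge0// => i _; rewrite fine_ge0// seq_rearrangement_ge0.
have F : Filter (almost_everywhere mu) by exact: (ae_filter_ringOfSetsType mu).
have ae_psum : {ae mu, forall x, x \in `[0%R, 1%R] ->
    (normc (psum A x) <= M * \sum_(n <- A) normc (c n))%R}.
  rewrite /psum; elim: (A) => [|i B IH].
    by apply/nearW => x _; rewrite !big_nil Normc.normc0 mulr0.
  move: IH (system_bounded i); apply: filterS2 => x IH hi x01.
  rewrite !big_cons mulrDr; apply: (le_trans (le_normcD _ _)); apply: lerD; last exact: IH.
  by rewrite Normc.normcM mulrC ler_wpM2r ?normc_ge0// hi.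
have fh : {ae mu, forall x, x \in `[0%R, 1%R] ->
    (normc (f x) <= M * S + normc (f x - psum A x))%R}.
  move: ae_psum; apply: filterS => x h x01.
  have -> : f x = (psum A x + (f x - psum A x))%R by ring.
  rewrite [X in (_ <= _ + normc X)%R](_ : _ = f x - psum A x)%R; last by ring.
  apply: (le_trans (le_normcD _ _)); rewrite lerD2r (le_trans (h x01))//.
  by rewrite ler_wpM2l.
have MS0 : (0 <= M * S)%R by exact: mulr_ge0.
apply: (le_trans (primitive_le MS0 t0 mf mh fh)).
rewrite [leRHS]EFinD leeD2l//; apply: (@le_trans _ _ (2%:E * (2 * T)%:E)).
  by apply: lee_wpmul2l.
by rewrite -EFinM lee_fin mulrA -natrM.
Qed.

End system.

(** * The main inequality *)

Section cauchy_schwarz.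
Context {R : realType}.

Lemma sqr_sum_le (u : nat -> R) m n :
  (\sum_(m <= i < n) u i) ^+ 2 <= (n - m)%:R * \sum_(m <= i < n) u i ^+ 2.
Proof.
set N : R := (n - m)%:R; set S := \sum_(m <= i < n) u i.
have [nm|mn] := leqP n m.
  by rewrite /S !big_geq// expr0n/= mulr0.
have N0 : 0 < N by rewrite ltr0n subn_gt0.
have : 0 <= \sum_(m <= i < n) (N * u i - S) ^+ 2 by rewrite sumr_ge0// => i _; rewrite sqr_ge0.
have -> : \sum_(m <= i < n) (N * u i - S) ^+ 2 =
    N ^+ 2 * (\sum_(m <= i < n) u i ^+ 2) - N * S ^+ 2.
  transitivity (\sum_(m <= i < n) (N ^+ 2 * u i ^+ 2 + (- (2 * N * S) * u i + S ^+ 2))).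
    by apply: eq_bigr => i _; ring.
  rewrite !big_split/= -!mulr_sumr -/S big_const_nat iter_addr addr0 -[_ *+ _]mulr_natl -/N.
  by ring.
rewrite subr_ge0 expr2 -mulrA ler_pM2l//.
Qed.

End cauchy_schwarz.

Section tails.
Context {R : realType} {I : choiceType} (c : I -> R[i]).
Hypothesis c2 : (\sum_(1 <= i <oo) seq_rearrangement c i ^+ 2 < +oo)%E.

Let sq_ge0 i : (0 <= seq_rearrangement c i ^+ 2)%E.
Proof. by rewrite expe_ge0// seq_rearrangement_ge0. Qed.

Definition tail_sq k : R := fine (\sum_(k <= i <oo) seq_rearrangement c i ^+ 2)%E.

(** This is S_k. *)
Definition tail k : R := Num.sqrt (tail_sq k).

Let r i : R := fine (seq_rearrangement c i).

Lemma tail_le_tail k l : (k <= l)%N ->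
  (\sum_(l <= i <oo) seq_rearrangement c i ^+ 2 <=
   \sum_(k <= i <oo) seq_rearrangement c i ^+ 2)%E.
Proof.
move=> kl; rewrite (@nneseries_split _ _ k (l - k)); last by move=> i _; exact: sq_ge0.
by rewrite subnKC// leeDr// sume_ge0// => i _; exact: sq_ge0.
Qed.

Lemma tail_sqE k : (1 <= k)%N ->
  (\sum_(k <= i <oo) seq_rearrangement c i ^+ 2)%E = (tail_sq k)%:E.
Proof.
move=> k1; rewrite fineK// ge0_fin_numE; last first.
  by apply: nneseries_ge0 => i _ _; exact: sq_ge0.
exact: le_lt_trans (tail_le_tail k1) c2.
Qed.

Lemma tail_sq_ge0 k : 0 <= tail_sq k.
Proof. by rewrite fine_ge0// nneseries_ge0// => i _ _; exact: sq_ge0. Qed.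

Lemma tail_ge0 k : 0 <= tail k. Proof. exact: sqrtr_ge0. Qed.

Lemma sqr_tail k : tail k ^+ 2 = tail_sq k.
Proof. by rewrite sqr_sqrtr// tail_sq_ge0. Qed.

Lemma tail_noninc k l : (1 <= k <= l)%N -> tail l <= tail k.
Proof.
move=> /andP[k1 kl]; rewrite ler_sqrt ?tail_sq_ge0// -lee_fin -!tail_sqE//.
  exact: tail_le_tail.
exact: leq_trans kl.
Qed.

Lemma seq_termE alpha k : (1 <= k)%N ->
  seq_term alpha c k = (log_weight alpha k%:R * tail k)%:E.
Proof.
by move=> k1; rewrite /seq_term tail_sqE// poweR_EFin powR12_sqrt// tail_sq_ge0.
Qed.

Lemma sum_rearrangement_le k l : (1 <= k)%N ->
  \sum_(k <= i < l) r i <= Num.sqrt (l - k)%:R * tail k.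
Proof.
move=> k1.
have r0 i : 0 <= r i by rewrite fine_ge0// seq_rearrangement_ge0.
rewrite /tail -sqrtrM// -[leLHS]ger0_norm ?sumr_ge0// -sqrtr_sqr ler_sqrt; last first.
  by rewrite mulr_ge0// tail_sq_ge0.
apply: (le_trans (sqr_sum_le _ _ _)); rewrite ler_wpM2l//.
rewrite -lee_fin -tail_sqE// -sumEFin.
have [lk|kl] := leqP l k.
  by rewrite big_geq// nneseries_ge0// => i _ _; exact: sq_ge0.
apply: (@le_trans _ _ (\sum_(k <= i < l) seq_rearrangement c i ^+ 2)%E); last first.
  by apply: nneseries_lim_ge => i _ _; exact: sq_ge0.
rewrite big_nat [leRHS]big_nat; apply: lee_sum => i /andP[ki _].
by rewrite EFin_expe fineK// seq_rearrangement_fin// (leq_trans k1).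
Qed.

End tails.

Lemma poweR_half_le {R : realType} (x : \bar R) (X Y : R) :
  (0 <= x)%E -> (x <= X%:E)%E -> X <= Y ^+ 2 -> 0 <= Y -> (x `^ 2^-1 <= Y%:E)%E.
Proof.
move=> x0 xX XY Y0; apply: (@le_trans _ _ ((Y ^+ 2)%:E `^ 2^-1)%E).
  by apply: ge0_lee_poweR; rewrite ?invr_ge0//; apply: le_trans xX _; rewrite lee_fin.
by rewrite poweR_EFin powR12_sqrt ?sqr_ge0// sqrtr_sqr ger0_norm.
Qed.

Section main_inequality.
Context {R : realType} (p : nat) (alpha : R).
Hypotheses (p1 : (1 <= p)%N) (palpha : 2 `^ `|alpha| * (2 ^- p) <= 1 / 2 :> R).
Let b := (4 ^ p)%N.
(** Equal to b^(-1/2), the factor by which t^(1/2) shrinks from one block to the next. *)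
Let beta : R := 2 ^- p.

Let b1 : (1 < b)%N.
Proof. by rewrite /b -{1}(expn0 4) ltn_exp2l. Qed.

Let b0 : (0 < b)%N. Proof. exact: ltnW. Qed.

Let beta0 : 0 < beta. Proof. by rewrite invr_gt0 exprn_gt0. Qed.

Let bE : b%:R = beta ^- 2 :> R.
Proof. rewrite /b /beta natrX exprVn invrK -exprM mulnC exprM; congr (_ ^+ p).
by rewrite -natrX.
Qed.

Variables (k : index_kind) (phi : index_type k -> R -> R[i]) (M : R).
Hypotheses (phio : orthonormal_system phi)
  (phiM : ereal_sup [set Lnorm01 +oo%E (phi n) | n in [set: index_type k]] = M%:E).
Variables (c : index_type k -> R[i]) (f : R -> R[i]).
Hypotheses (fc : is_sum c phi f)
  (c2 : (\sum_(1 <= i <oo) seq_rearrangement c i ^+ 2 < +oo)%E).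
Variable J : nat.
Hypothesis MJ : M ^+ 2 <= b%:R ^+ J.

Let r i : R := fine (seq_rearrangement c i).
Let s j := tail c (b ^ j)%N.
(** The bound of [primitive_approximation] at t = b^-(J+j) and N = b^j after M t^(1/2) <= beta^j.
    The tail starts at b^j instead of b^j + 1, which only enlarges it and matches the condensed
    sum. *)
Let V j := beta ^+ j * (\sum_(1 <= i < (b ^ j).+1) r i) + s j.
Let F m := if (m < J)%N then 2 * s 0%N else 2 * V (m - J)%N.

Let r0 i : 0 <= r i. Proof. by rewrite fine_ge0// seq_rearrangement_ge0. Qed.
Let s0 j : 0 <= s j. Proof. exact: tail_ge0. Qed.
Let V0 j : 0 <= V j.
Proof. by rewrite addr_ge0// mulr_ge0 ?exprn_ge0 ?(ltW beta0)// sumr_ge0. Qed.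
Let F0 m : 0 <= F m. Proof. by rewrite /F; case: ifPn => _; rewrite mulr_ge0. Qed.

Let bj0 j : (0 < b ^ j)%N. Proof. by rewrite expn_gt0 b0. Qed.

Let betab j : beta ^+ j * Num.sqrt (b ^ j)%:R = 1.
Proof.
have bj : (b ^ j)%:R = (beta ^- j) ^+ 2 :> R.
  by rewrite natrX bE; move: beta => x; rewrite !exprVn -!exprM mulnC.
by rewrite bj sqrtr_sqr ger0_norm ?invr_ge0 ?exprn_ge0 ?(ltW beta0)// divff// gt_eqF// exprn_gt0.
Qed.

Let V0s : V 0 <= 2 * s 0.
Proof.
rewrite /V expr0 mul1r mulr_natl mulr2n lerD2r /s expn0.
by have := sum_rearrangement_le c2 2 (leqnn 1); rewrite subSS subn0 sqrtr1 mul1r.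
Qed.

Let VS j : V j.+1 <= beta * V j + 2 * s j.
Proof.
have bb : (b ^ j <= b ^ j.+1)%N by rewrite leq_exp2l.
rewrite /V (@big_cat_nat _ _ _ (b ^ j).+1)//= mulrDr.
(* Cauchy-Schwarz over at most b^(j+1) new terms, whose square root [beta ^+ j.+1] cancels exactly.
   The other [s j] of the claim comes from the monotonicity of the tails. *)
have h1 : beta ^+ j.+1 * (\sum_((b ^ j).+1 <= i < (b ^ j.+1).+1) r i) <= s j.
  apply: (@le_trans _ _ (beta ^+ j.+1 * (Num.sqrt (b ^ j.+1)%:R * s j))); last first.
    by rewrite mulrA betab mul1r.
  rewrite ler_wpM2l ?exprn_ge0 ?(ltW beta0)//.
  apply: (le_trans (sum_rearrangement_le c2 _ (ltn0Sn _))).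
  rewrite ler_pM ?sqrtr_ge0 ?tail_ge0//.
    by rewrite ler_sqrt// ler_nat subSS leq_subr.
  by apply: tail_noninc => //; rewrite bj0 leqnSn.
have h2 : s j.+1 <= s j by apply: tail_noninc => //; rewrite bj0.
have h3 : 0 <= beta * s j by rewrite mulr_ge0// ltW.
rewrite exprS in h1 *.
set A := \sum_(1 <= i < _) r i; set B := \sum_(_.+1 <= i < _) r i in h1 *.
have -> : beta * (beta ^+ j * A + s j) = beta * beta ^+ j * A + beta * s j by ring.
by move: h1 h2 h3; lra.
Qed.

(** The factor 2 in [F] absorbs the constants, since 2 u^2 + 4 v^2 <= (2 (u + v))^2 for u, v >=
    0. *)
Let primitive_F m :
  ((\int[@lebesgue_measure R]_(x in `]0%R, (b%:R ^- m : R)[)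
     rearrangement f x ^+ 2) `^ 2^-1 <= (F m)%:E)%E.
Proof.
have d0 : 0 < b%:R ^- m :> R by rewrite invr_gt0 exprn_gt0// ltr0n.
have M1 := system_bound_ge1 phio phiM.
rewrite /F; case: ifPn => mJ.
  (* With N = 0 no coefficient is split off and the bound is 2 S_1 for every t. *)
  have := primitive_approximation phio phiM fc c2 0 (ltW d0).
  rewrite big_geq// mulr0 expr0n/= mulr0 mul0r add0r => h.
  apply: (poweR_half_le _ h); [exact: primitive_ge0| |by rewrite mulr_ge0].
  by rewrite exprMn /s expn0 sqr_tail -natrX.
rewrite -leqNgt in mJ; set j := (m - J)%N.
have := primitive_approximation phio phiM fc c2 (b ^ j) (ltW d0).
set A := \sum_(1 <= i < _) _ => h.
apply: (poweR_half_le _ h); [exact: primitive_ge0| |by rewrite mulr_ge0].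
have hV : V j = beta ^+ j * A + s j by [].
have A0 : 0 <= A by rewrite sumr_ge0// => i _; exact: r0.
have T1 : fine (\sum_((b ^ j).+1 <= i <oo) seq_rearrangement c i ^+ 2)%E <= s j ^+ 2.
  rewrite -[leLHS]sqr_tail ler_pXn2r ?nnegrE ?tail_ge0//.
  by apply: tail_noninc => //; rewrite bj0 leqnSn.
(* Here the choice of J is used: [MJ] trades M^2 for b^J, which the shift of m by J pays back. *)
have Md : M ^+ 2 * b%:R ^- m <= (beta ^+ j) ^+ 2.
  rewrite ler_pdivrMr ?exprn_gt0 ?ltr0n//; apply: (le_trans MJ).
  have -> : m = (j + J)%N by rewrite subnK.
  rewrite exprD mulrA -exprM mulnC exprM -exprMn.
  by rewrite bE mulfV ?mul1r ?expr1n ?mul1r// expf_neq0// gt_eqF.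
have bA : 0 <= beta ^+ j * A * s j.
  by rewrite !mulr_ge0 ?exprn_ge0// ltW.
have MA : (M * A) ^+ 2 * b%:R ^- m <= (beta ^+ j * A) ^+ 2.
  by rewrite !exprMn mulrAC ler_wpM2r ?sqr_ge0.
have : 0 <= (beta ^+ j * A) ^+ 2 by rewrite sqr_ge0.
rewrite hV; move: bA T1 MA; move: (beta ^+ j * A) (s j) (fine _) => u v T.
rewrite -[2 * _ / _]mulrA; move: ((M * A) ^+ 2 / _) => Y; nra.
Qed.

Let lam : R := ln b%:R.
Let W := wratio lam `^ `|alpha|.

Let FJ m : (m < J)%N -> F m <= 2 * s 0.
Proof. by move=> mJ; rewrite /F mJ. Qed.

Let FV j : F (J + j) <= 2 * V j.
Proof. by rewrite /F ltnNge leq_addr/= addKn. Qed.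

Lemma fun_norm_sup_le X : (seq_norm +oo alpha c <= X%:E)%E ->
  (fun_norm +oo alpha f <=
   (W * (4 * 2 `^ `|alpha| * 2 * (1 + J%:R) `^ `|alpha| * (W * X)))%:E)%E.
Proof.
move=> cX; apply: (fun_norm_le_sup b1 primitive_F).
apply: (dyadic_sup_le s0 F0 V0 (ler0n R 2) palpha V0s VS FJ FV) => //.
apply: dyadic_le_sup => //; first by move=> i; exact: tail_ge0.
move=> i i1; rewrite -lee_fin -(seq_termE c2)//; apply: le_trans cX.
by apply: ereal_sup_ubound; exists i.
Qed.

Lemma fun_norm_sum_le (q Q : R) : 0 < q ->
  (\sum_(1 <= i <oo) (seq_term alpha c i `^ q * (i%:R^-1)%:E) <= Q%:E)%E ->
  (fun_norm q%:E alpha f <= ((b%:R * W `^ q *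
    ((1 + (1 + 3 `^ q) / (1 - (3 / 4) `^ q)) * (2 * 2 `^ `|alpha|) `^ q *
    (2 `^ q * ((1 + J%:R) `^ `|alpha|) `^ q * (1 + J%:R)) *
    ((1 + 2 * (2 `^ `|alpha| * W) `^ q) * Q))) `^ q^-1)%:E)%E.
Proof.
move=> q0 cQ; apply: (fun_norm_le_sum b1 F0 primitive_F q0) => n.
apply: (le_trans (dyadic_sum_le s0 F0 V0 (ler0n R 2) palpha V0s VS FJ FV n q0)) => //.
apply: ler_wpM2l.
  have : 0 <= (1 + 3 `^ q) / (1 - (3 / 4) `^ q).
    apply: divr_ge0; first by rewrite addr_ge0// powR_ge0.
    by rewrite subr_ge0 ltW// powR_lt1//; lra.
  by move=> h; apply: mulr_ge0; apply: mulr_ge0; rewrite ?addr_ge0 ?powR_ge0.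
apply: (@le_trans _ _ (\sum_(j < n.+1) (dweight alpha j * s j) `^ q)).
  by rewrite big_ord_recr/= lerDl powR_ge0.
apply: (@le_trans _ _ ((1 + 2 * (2 `^ `|alpha| * W) `^ q) *
    \sum_(1 <= i < (b ^ n).+1) ((log_weight alpha i%:R * tail c i) `^ q / i%:R))).
  apply: dyadic_le_series => //; first by move=> i; exact: tail_ge0.
  by move=> i l; exact: tail_noninc.
apply: ler_wpM2l; first by rewrite addr_ge0// mulr_ge0// powR_ge0.
rewrite -lee_fin -sumEFin; apply: le_trans cQ.
apply: (@le_trans _ _ (\sum_(1 <= i < (b ^ n).+1)
    (seq_term alpha c i `^ q * (i%:R^-1)%:E))%E).
  rewrite big_nat [leRHS]big_nat; apply: lee_sum => i /andP[i1 _].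
  by rewrite (seq_termE c2)// poweR_EFin -EFinM.
apply: nneseries_lim_ge => i _ _.
by rewrite mule_ge0 ?poweR_ge0// lee_fin invr_ge0.
Qed.

End main_inequality.

(** * Convergence *)

Section rapid_convergence.
Context {R : realType}.

Lemma rapid_cvg (u : nat -> R) (C : R) :
  (forall j, `|u j.+1 - u j| <= C * 2^-1 ^+ j) -> cvgn u.
Proof.
move=> uC.
have C0 : 0 <= C by have := le_trans (normr_ge0 _) (uC 0%N); rewrite expr0 mulr1.
have h : cvgn (series (telescope u)).
  apply: normed_cvg.
  apply: (@series_le_cvg _ _ (geometric C 2^-1)) => [n|n|n|].
  - exact: normr_ge0.
  - by rewrite /geometric/= mulr_ge0// exprn_ge0// invr_ge0.
  - by rewrite /geometric/= /telescope; exact: uC.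
  - by apply: is_cvg_geometric_series; rewrite ger0_norm ?invr_ge0// invf_lt1// ltr1n.
rewrite (_ : u = (fun n => u 0%N + series (telescope u) n)).
  by apply: is_cvgD => //; exact: is_cvg_cst.
by apply/funext => n; rewrite -eq_sum_telescope.
Qed.

Lemma cvg_EFin_seq (u : nat -> R) (l : R) : u n @[n --> \oo] --> l ->
  (u n)%:E @[n --> \oo] --> l%:E.
Proof. by move=> ul; apply/fine_cvgP; split => //; exact: nearW. Qed.

Lemma fine_limn_esup (u : nat -> R) (l : R) : u n @[n --> \oo] --> l ->
  fine (limn_esup (fun n => (u n)%:E)) = l.
Proof.
move=> /cvg_EFin_seq ul; rewrite is_cvg_limn_esupE; last by apply/cvg_ex; exists l%:E.
by move/cvg_lim : ul => ->.
Qed.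

Lemma limn_einf_le (u : nat -> \bar R) (e : \bar R) N :
  (forall n, (N <= n)%N -> (u n <= e)%E) -> (limn_einf u <= e)%E.
Proof.
move=> ue; rewrite limn_einf_lim; apply: lime_le.
  by apply: ereal_nondecreasing_is_cvgn; exact: nondecreasing_einfs.
near=> n; apply: (@le_trans _ _ (u n)).
  by apply: ereal_inf_lbound; exists n => /=.
by apply: ue; near: n; exact: nbhs_infty_ge.
Unshelve. all: by end_near.
Qed.

End rapid_convergence.

(** * Limits of rapidly Cauchy sequences in L_2 *)

Section completeness.
Context {R : realType}.
Local Notation mu := (@lebesgue_measure R).
Local Notation normc := Normc.normc.
Local Notation I01 := (`[0%R, 1%R]%classic : set R).
Variable g : nat -> R -> R[i].
Hypothesis mg : forall j, cmeasurable (g j).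
(* So that the sum of 4^j |g_{j+1} - g_j|^2 has integral at most 1. *)
Hypothesis rapid : forall j,
  (energy (fun x => g j.+1 x - g j x)%R <= ((4 ^+ j * 2 ^+ j.+1)^-1)%:E)%E.

Let mI01 : measurable I01. Proof. exact: measurable_itv. Qed.

Let D j x := normc (g j.+1 x - g j x).

Let mD j : measurable_fun I01 (fun x => (4 ^+ j * D j x ^+ 2)%:E).
Proof.
apply/measurable_EFinP; apply: measurable_funM => //.
by apply: cmeasurable_sqr_normc; exact: cmeasurableB.
Qed.

Let D0 j x : (0 <= (4 ^+ j * D j x ^+ 2)%:E)%E.
Proof. by rewrite lee_fin mulr_ge0// ?exprn_ge0// normc_ge0. Qed.

Lemma rapid_ae_bounded :
  {ae mu, forall x, I01 x -> exists C : R, forall j, D j x <= C * 2^-1 ^+ j}.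
Proof.
have F : Filter (almost_everywhere mu) by exact: (ae_filter_ringOfSetsType mu).
pose G x := (\sum_(0 <= j <oo) (4 ^+ j * D j x ^+ 2)%:E)%E.
have G0 x : (0 <= G x)%E by apply: nneseries_ge0.
have iG : mu.-integrable I01 G.
  apply/integrableP; split.
    by apply: ge0_emeasurable_sum => [j x _ _|j _]; [exact: D0|exact: mD].
  under eq_integral do rewrite gee0_abs//.
  rewrite integral_nneseries//.
  apply: (@le_lt_trans _ _ (\sum_(0 <= j <oo) (1 / (2 ^ j.+1)%:R)%:E)%E).
    apply: lee_nneseries => [j _ _|j _]; first by apply: integral_ge0.
    under eq_integral do rewrite EFinM.
    rewrite ge0_integralZl//; first last.
    - by move=> x _; rewrite lee_fin exprn_ge0// normc_ge0.
    - apply/measurable_EFinP; apply: cmeasurable_sqr_normc; exact: cmeasurableB.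
    apply: (@le_trans _ _ ((4 ^+ j)%:E * ((4 ^+ j * 2 ^+ j.+1)^-1)%:E)%E).
      by apply: lee_wpmul2l; [rewrite lee_fin exprn_ge0|exact: rapid].
    by rewrite -EFinM lee_fin invfM mulrA divff ?mul1r ?div1r ?natrX// expf_neq0.
  have := @epsilon_trick0 R 1 xpredT ler01; move=> /le_lt_trans; apply; exact: ltry.
have : {ae mu, forall x, I01 x -> G x \is a fin_num}.
  exact: (@integrable_ae _ _ _ mu).
apply: filterS => x /= + x01.
(* Each single term 4^j |D j x|^2 is at most the finite sum G x; the witness comes from taking
   square roots. *)
move=> /(_ x01) Gx; exists (Num.sqrt (fine (G x))) => j.
have Gx0 : 0 <= fine (G x) by rewrite fine_ge0.
rewrite -(ler_pXn2r (ltn0Sn 1)); last 2 first.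
- by rewrite nnegrE normc_ge0.
- by rewrite nnegrE mulr_ge0// ?sqrtr_ge0// exprn_ge0// invr_ge0.
rewrite exprMn sqr_sqrtr// -exprM mulnC exprM exprVn -natrX.
rewrite exprVn ler_pdivlMr ?exprn_gt0// mulrC -lee_fin fineK//.
exact: (term_le_nneseries (fun j => D0 j x) (leq0n j)).
Qed.

(** An upper limit is measurable without any convergence; on the null set where the sequence may
    diverge, [fine] sends infinite values to 0. *)
Let limf x : R[i] := Complex
  (fine (limn_esup (fun j => (complex.Re (g j x))%:E)))
  (fine (limn_esup (fun j => (complex.Im (g j x))%:E))).

Lemma cmeasurable_rapid_limit : cmeasurable limf.
Proof.
by split; apply: (measurableT_comp (fine_measurable measurableT));
  apply: measurable_fun_limn_esup => j; apply/measurable_EFinP; have [] := mg j.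
Qed.

Lemma rapid_ae_cvg : {ae mu, forall x, I01 x ->
  complex.Re (g j x) @[j --> \oo] --> complex.Re (limf x) /\
  complex.Im (g j x) @[j --> \oo] --> complex.Im (limf x)}.
Proof.
have F : Filter (almost_everywhere mu) by exact: (ae_filter_ringOfSetsType mu).
have := rapid_ae_bounded; apply: filterS => x /= + x01 => /(_ x01)[C DC].
split.
- have /cvg_ex[l ul] : cvgn (fun j => complex.Re (g j x)).
    apply: (@rapid_cvg R _ C) => j; apply: le_trans (DC j).
    by apply: le_trans (Re_le_normc _); rewrite complex_ReD; case: (g j x).
  by rewrite (fine_limn_esup ul).
- have /cvg_ex[l ul] : cvgn (fun j => complex.Im (g j x)).
    apply: (@rapid_cvg R _ C) => j; apply: le_trans (DC j).
    by apply: le_trans (Im_le_normc _); rewrite complex_ImD; case: (g j x).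
  by rewrite (fine_limn_esup ul).
Qed.

(** Fatou applied to |g j - h|^2. The arbitrary [h] lets one statement give both membership in L_2,
    with h = 0, and convergence, with h a window sum. *)
Lemma rapid_complete : exists2 f, cmeasurable f &
  forall (h : R -> R[i]) (e : R) N, cmeasurable h ->
  (forall j, (N <= j)%N -> (energy (fun x => g j x - h x)%R <= e%:E)%E) ->
  (energy (fun x => f x - h x)%R <= e%:E)%E.
Proof.
exists limf; first exact: cmeasurable_rapid_limit.
move=> h e N mh ge.
have mgh j : measurable_fun I01 (fun x => (normc (g j x - h x) ^+ 2)%:E).
  by apply/measurable_EFinP; apply: cmeasurable_sqr_normc; exact: cmeasurableB.
apply: (@le_trans _ _ (\int[mu]_(x in I01)
    limn_einf (fun j => (normc (g j x - h x) ^+ 2)%:E))%E); last first.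
  apply: le_trans (fatou mu mI01 mgh _) _.
    by move=> j x _; rewrite lee_fin exprn_ge0// normc_ge0.
  exact: limn_einf_le ge.
apply: ae_ge0_le_integral => //.
- by move=> x _; rewrite lee_fin exprn_ge0// normc_ge0.
- apply/measurable_EFinP; apply: cmeasurable_sqr_normc.
  by apply: cmeasurableB => //; exact: cmeasurable_rapid_limit.
- move=> x _; rewrite limn_einf_lim; apply: lime_ge.
    by apply: ereal_nondecreasing_is_cvgn; exact: nondecreasing_einfs.
  apply: nearW => n; apply/ereal_infP => _ [j _ <-].
  by rewrite lee_fin exprn_ge0// normc_ge0.
- rewrite (_ : (fun x => _) = (fun x => - limn_esup (fun j => - (normc (g j x - h x) ^+ 2)%:E))%E).
    apply: measurableT_comp => //; apply: measurable_fun_limn_esup => j.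
    by apply: (measurableT_comp _ (mgh j)).
  by apply/funext => x; rewrite limn_esupN oppeK.
have F : Filter (almost_everywhere mu) by exact: (ae_filter_ringOfSetsType mu).
have := rapid_ae_cvg; apply: filterS => x /= + x01 => /(_ x01)[cR cI].
have cj : (normc (g j x - h x) ^+ 2)%:E @[j --> \oo] --> (normc (limf x - h x) ^+ 2)%:E.
  apply: cvg_EFin_seq; rewrite sqr_normc.
  under eq_fun do rewrite sqr_normc.
  rewrite !complex_ReD !complex_ImD.
  under eq_fun do rewrite complex_ReD complex_ImD.
  by apply: cvgD; rewrite !expr2; apply: cvgM; apply: cvgD => //; exact: cvg_cst.
rewrite is_cvg_limn_einfE; last by apply/cvg_ex; eexists; exact: cj.
by move/cvg_lim : cj => ->.
Qed.

End completeness.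

Lemma nneseries_tail_le {R : realType} (v : nat -> \bar R) m (e : R) :
  (forall i, 0 <= v i)%E -> (\sum_(m <= i <oo) v i < +oo)%E -> 0 < e ->
  exists2 n, (m <= n)%N & (\sum_(n <= i <oo) v i <= e%:E)%E.
Proof.
move=> v0 vfin e0.
have c0 := @nneseries_tail_cvg R v (fun i => (m <= i)%N).
rewrite eseries_cond in vfin; have {}c0 := c0 vfin (fun i _ => v0 i).
have h : nbhs (0 : \bar R) [set y | (y < e%:E)%E].
  by have := @nbhs_open_ereal_lt R 0%R (cst e) e0.
have [N _ HN] := c0 _ h.
exists (maxn m N); first exact: leq_maxl.
have /= /ltW := HN (maxn m N) (leq_maxr _ _).
apply: le_trans; rewrite eseries_cond [leRHS]eseries_cond le_eqVlt.
apply/orP; left; apply/eqP; apply: eq_eseriesl => i /=.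
by rewrite geq_max; case: (m <= i)%N.
Qed.

Section dominated_series.
Context {R : realType} {T : Type} (F : set_system T) (FF : Filter F).
Local Open Scope ereal_scope.

(** Dominated convergence along an arbitrary filter, as needed for two-sided windows: past some n
    the dominating series is below e / 2, and before n there are finitely many terms, each
    eventually small. *)
Lemma dominated_series (u : T -> nat -> \bar R) (v : nat -> \bar R) m :
  (forall x i, 0 <= u x i) -> (forall i, 0 <= v i) -> (forall x i, u x i <= v i) ->
  \sum_(m <= i <oo) v i < +oo ->
  (forall i, (m <= i)%N -> forall e : R, (0 < e)%R -> \forall x \near F, u x i <= e%:E) ->
  forall e : R, (0 < e)%R -> \forall x \near F, \sum_(m <= i <oo) u x i <= e%:E.
Proof.
move=> u0 v0 uv vfin usmall e e0.
have e20 : (0 < e / 2)%R by rewrite divr_gt0.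
have [n mn ne] := nneseries_tail_le v0 vfin e20.
have finite_part : forall n (d : R), (0 < d)%R ->
    \forall x \near F, \sum_(m <= i < n) u x i <= d%:E.
  elim=> [|N IH] d d0.
    by apply: nearW => x; rewrite big_geq// lee_fin ltW.
  have [mN|Nm] := leqP m N; last first.
    by apply: nearW => x; rewrite big_geq// lee_fin ltW.
  have d20 : (0 < d / 2)%R by rewrite divr_gt0.
  move: (IH _ d20) (usmall _ mN _ d20); apply: filterS2 => x h1 h2.
  by rewrite big_nat_recr//= [d]splitr EFinD; apply: leeD.
move: (finite_part n _ e20); apply: filterS => x h.
rewrite (@nneseries_split _ _ m (n - m)); last by move=> i _; exact: u0.
rewrite subnKC// [e]splitr EFinD; apply: leeD => //.
by apply: le_trans ne; apply: lee_nneseries => i _ //.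
Qed.

End dominated_series.

(** * Remainders outside a window, and existence of the sum *)

Section off_window.
Context {R : realType} {k : index_kind}.
Local Notation normc := Normc.normc.
Implicit Types (c : index_type k -> R[i]).
Local Open Scope ereal_scope.

(** The coefficients of f minus its window sum, so that the main inequality can be applied to the
    remainder. *)
Definition off_window c (mn : nat * nat) : index_type k -> R[i] :=
  fun i => if i \in window k mn.1 mn.2 then 0%R else c i.

Lemma off_window_le c mn i : (normc (off_window c mn i) <= normc (c i))%R.
Proof. by rewrite /off_window; case: ifPn => // _; rewrite Normc.normc0 normc_ge0. Qed.

Lemma window_sub m n m' n' : (m <= m')%N -> (n <= n')%N ->
  {subset window k m n <= window k m' n'}.
Proof.
case: k => mm nn x /=; first by rewrite !mem_iota; lia.
move=> /mapP[z + ->]; rewrite mem_iota => /andP[_ imn].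
apply/mapP; exists (z + (m' - m))%N; first by rewrite mem_iota; lia.
by lia.
Qed.

Let FF : Filter (filter_prod (\oo : set_system nat) (\oo : set_system nat)).
Proof. exact: filter_prod_filter. Qed.

(** Only finitely many |c n| exceed the square root of e, and a large window contains all of those
    indices. *)
Lemma off_window_rearrangement_near c i :
  \sum_(1 <= j <oo) seq_rearrangement c j ^+ 2 < +oo ->
  forall e : R, (0 < e)%R ->
  \forall mn \near filter_prod \oo \oo,
    seq_rearrangement (off_window c mn) i ^+ 2 <= e%:E.
Proof.
move=> c2 e e0.
have se0 : (0 < Num.sqrt e)%R by rewrite sqrtr_gt0.
have [t tE] := (finite_seqP _).1 (finite_superlevel c2 se0).
have := window_near t; apply: filterS => -[m n] tmn.
have h : seq_rearrangement (off_window c (m, n)) i <= (Num.sqrt e)%:E.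
  apply: le_sup_seq_rearrangement; first exact: ltW.
  move=> j; rewrite /off_window; case: ifPn => [_|jW].
    by rewrite Normc.normc0 ltW.
  rewrite leNgt; apply: contra jW => cj; apply: tmn.
  by have : [set` t] j by rewrite -tE.
rewrite -[in leRHS](sqr_sqrtr (ltW e0)) EFin_expe !expe2.
by apply: lee_pmul; rewrite ?seq_rearrangement_ge0.
Qed.

Lemma off_window_sum_near c :
  \sum_(1 <= j <oo) seq_rearrangement c j ^+ 2 < +oo ->
  forall e : R, (0 < e)%R ->
  \forall mn \near filter_prod \oo \oo,
    \sum_(1 <= i <oo) seq_rearrangement (off_window c mn) i ^+ 2 <= e%:E.
Proof.
move=> c2; apply: (@dominated_series _ _ _ FF _ (fun i => seq_rearrangement c i ^+ 2)) => //.
- by move=> x i; rewrite expe_ge0// seq_rearrangement_ge0.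
- by move=> i; rewrite expe_ge0// seq_rearrangement_ge0.
- move=> x i; rewrite !expe2; apply: lee_pmul; rewrite ?seq_rearrangement_ge0//;
  by apply: le_seq_rearrangement => n; exact: off_window_le.
- by move=> i _ e e0; exact: off_window_rearrangement_near.
Qed.

Lemma off_window_sum_lty c mn :
  \sum_(1 <= j <oo) seq_rearrangement c j ^+ 2 < +oo ->
  \sum_(1 <= j <oo) seq_rearrangement (off_window c mn) j ^+ 2 < +oo.
Proof.
apply: le_lt_trans; apply: lee_nneseries => i _; first by move=> _; rewrite expe_ge0// seq_rearrangement_ge0.
rewrite !expe2; apply: lee_pmul; rewrite ?seq_rearrangement_ge0//;
by apply: le_seq_rearrangement => n; exact: off_window_le.
Qed.

Section system.
Context (phi : index_type k -> R -> R[i]) (c : index_type k -> R[i]).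
Hypothesis phio : orthonormal_system phi.

Let psum (s : seq (index_type k)) : R -> R[i] := fun x => (\sum_(i <- s) c i * phi i x)%R.

Let psum_L2 s : inL2 (psum s).
Proof. by apply: inL2_sum => i; apply: inL2Z; case: phio. Qed.

Let mpsum s : cmeasurable (psum s). Proof. by have [] := psum_L2 s. Qed.

Lemma psum_sub (d : index_type k -> R[i]) (W W' : seq (index_type k)) x :
  uniq W -> uniq W' -> {subset W <= W'} ->
  (\sum_(i <- W') d i * phi i x =
   \sum_(i <- W) d i * phi i x + \sum_(i <- [seq i <- W' | i \notin W]) d i * phi i x)%R.
Proof.
move=> uW uW' WW'; rewrite (bigID (mem W))/=; congr (_ + _)%R; last by rewrite big_filter.
rewrite -big_filter; apply: perm_big; apply: uniq_perm => //.
  by rewrite filter_uniq.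
by move=> i; rewrite mem_filter/=; case: (boolP (i \in W)) => //= /WW' ->.
Qed.

(** As soon as a later window contains the given one, the remainders of the two series are the same
    function. *)
Lemma is_sum_off_window f mn : is_sum c phi f ->
  is_sum (off_window c mn) phi (fun x => f x - partial_sum c phi mn.1 mn.2 x)%R.
Proof.
case: mn => m n; move=> [f2 cvgf]; split; first by apply: inL2B => //; exact: psum_L2.
apply: (@cvge0 _ _ _ FF); first by move=> x; exact: Lnorm_ge0.
move=> e e0; have h := @cvge0_le R _ _ FF _ cvgf e e0.
move: h (window_near (window k m n)); apply: filterS2 => -[m' n'] /= h sub.
rewrite (_ : (fun x => _) = (fun x => f x - partial_sum c phi m' n' x))%R//.
apply/funext => x; rewrite /partial_sum (psum_sub c x _ _ sub) ?window_uniq//.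
rewrite (psum_sub (off_window c (m, n)) x _ _ sub) ?window_uniq//.
have -> : (\sum_(i <- window k m n) off_window c (m, n) i * phi i x = 0)%R.
  by rewrite big_seq big1// => i iW; rewrite /off_window/= iW mul0r.
have -> : (\sum_(i <- [seq i <- window k m' n' | i \notin window k m n])
    off_window c (m, n) i * phi i x =
  \sum_(i <- [seq i <- window k m' n' | i \notin window k m n]) c i * phi i x)%R.
  apply: eq_big_seq => i.
  by rewrite mem_filter /off_window/= => /andP[/negbTE ->].
by ring.
Qed.

Hypothesis c2 : \sum_(1 <= j <oo) seq_rearrangement c j ^+ 2 < +oo.

Lemma energy_psum_sub m n m' n' (e : R) : (m <= m')%N -> (n <= n')%N ->
  \sum_(1 <= i <oo) seq_rearrangement (off_window c (m, n)) i ^+ 2 <= e%:E ->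
  energy (fun x => psum (window k m' n') x - psum (window k m n) x)%R <= e%:E.
Proof.
move=> mm nn oe.
have sub := window_sub mm nn.
rewrite (_ : (fun x => _) = psum [seq i <- window k m' n' | i \notin window k m n]); last first.
  apply/funext => x; rewrite /psum (psum_sub c x _ _ sub) ?window_uniq//; ring.
have uB : uniq [seq i <- window k m' n' | i \notin window k m n].
  by rewrite filter_uniq// window_uniq.
rewrite (energy_orthonormal_sum c phio uB); apply: le_trans oe.
rewrite (eq_big_seq (fun i => normc (off_window c (m, n) i) ^+ 2)%R); last first.
  by move=> i; rewrite mem_filter /off_window/= => /andP[/negbTE ->].
by apply: sum_sqr_le uB; exact: off_window_sum_lty.
Qed.

Lemma riesz_fischer : exists f, is_sum c phi f.
Proof.
pose ej (j : nat) : R := ((4 ^+ j * 2 ^+ j.+1)^-1)%R.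
have ej0 j : (0 < ej j)%R by rewrite invr_gt0 mulr_gt0// exprn_gt0.
have /choice[N HN] : forall j, exists N, forall m n, (N <= m)%N -> (N <= n)%N ->
    \sum_(1 <= i <oo) seq_rearrangement (off_window c (m, n)) i ^+ 2 <= (ej j)%:E.
  move=> j; have [[P Q] [/= [N1 _ P1] [N2 _ Q1]] PQ] := off_window_sum_near c2 (ej0 j).
  exists (maxn N1 N2) => m n; rewrite !geq_max => /andP[Nm _] /andP[_ Nn].
  by apply: (PQ (m, n)); split => /=; [exact: P1|exact: Q1].
(* Monotone so that consecutive windows are nested, at least N j for the rapid decay, and at least j
   so that the windows exhaust the indices. *)
pose L j := (\sum_(i < j.+1) N i + j)%N.
have LN j : (N j <= L j)%N by rewrite /L big_ord_recr/= -addnA addnCA leq_addr.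
have Lmono j : (L j <= L j.+1)%N.
  by rewrite /L (big_ord_recr j.+1)/= addnS; apply: leqW; rewrite leq_add2r leq_addr.
have Lj j : (j <= L j)%N by rewrite leq_addl.
pose g j := psum (window k (L j) (L j)).
have rapid j : energy (fun x => g j.+1 x - g j x)%R <= ((4 ^+ j * 2 ^+ j.+1)^-1)%:E.
  by apply: energy_psum_sub => //; exact: HN.
have [f mf limf] := rapid_complete (fun j => mpsum _) rapid.
have f2 : inL2 f.
  apply/inL2E; split => //.
  (* Comparison with h = 0: every window sum has energy at most the full square sum. *)
  have -> : f = (fun x => f x - 0)%R by apply/funext => x; rewrite subr0.
  apply: (@le_lt_trans _ _ (tail_sq c 1)%:E); last exact: ltry.
  apply: (limf (fun=> 0%R) _ 0%N); first by split; exact: measurable_cst.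
  move=> j _; rewrite (_ : (fun x => _) = g j); last by apply/funext => x; rewrite subr0.
  by rewrite (energy_orthonormal_sum c phio (window_uniq _ _ _)) -tail_sqE// sum_sqr_le// window_uniq.
exists f; split => //.
apply: (@cvge0 _ _ _ FF); first by move=> x; exact: Lnorm_ge0.
move=> e e0; have e20 : (0 < e ^+ 2)%R by rewrite exprn_gt0.
have := off_window_sum_near c2 e20; apply: filterS => -[m n] /= h.
rewrite Lnorm01_2E; apply: (poweR_half_le (energy_ge0 _)) (lexx _) (ltW e0).
(* From this index on, L j >= j makes the window of [g j] contain the window (m, n). *)
apply: (limf (psum (window k m n)) _ (maxn m n)) => // j.
rewrite geq_max => /andP[mj nj].
by apply: energy_psum_sub => //; apply: leq_trans (Lj j).
Qed.

End system.

Lemma seq_term_ge0 alpha c i : 0 <= seq_term alpha c i.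
Proof. by rewrite mule_ge0 ?poweR_ge0// lee_fin ltW// log_weight_gt0. Qed.

Lemma le_seq_term alpha c c' i : (forall n, normc (c' n) <= normc (c n))%R ->
  seq_term alpha c' i <= seq_term alpha c i.
Proof.
move=> cc; apply: lee_wpmul2l; first by rewrite lee_fin ltW// log_weight_gt0.
apply: ge0_lee_poweR; rewrite ?invr_ge0//.
  by apply: nneseries_ge0 => j _ _; rewrite expe_ge0// seq_rearrangement_ge0.
apply: lee_nneseries => j _; first by move=> _; rewrite expe_ge0// seq_rearrangement_ge0.
by rewrite !expe2; apply: lee_pmul; rewrite ?seq_rearrangement_ge0// le_seq_rearrangement.
Qed.

(** The term k = 1 carries weight 1 and is the square root of the full square sum. *)
Lemma seq_norm_lty_sq q alpha c : 0 < q -> seq_norm q alpha c < +oo ->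
  \sum_(1 <= j <oo) seq_rearrangement c j ^+ 2 < +oo.
Proof.
move=> q0 cq.
suff : seq_term alpha c 1 < +oo.
  rewrite /seq_term log_weight1 mul1e => /lty_poweRy; apply.
  by rewrite invr_neq0.
case: q q0 cq => [r| |//]; last first.
  move=> _ /=; apply: le_lt_trans; apply: ereal_sup_ubound; by exists 1%N.
rewrite lte_fin => r0 /lty_poweRy h.
have {}h := h (invr_neq0 (lt0r_neq0 r0)).
apply: (@lty_poweRy _ _ r); first exact: lt0r_neq0.
apply: le_lt_trans h.
have := @term_le_nneseries R
  (fun j => seq_term alpha c j `^ r * (j%:R^-1)%:E) 1 1 _ (leqnn 1).
rewrite invr1 mule1; apply => j.
by rewrite mule_ge0 ?poweR_ge0// lee_fin invr_ge0.
Qed.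

Lemma off_window_norm_near (r alpha : R) c : (0 < r)%R ->
  seq_norm r%:E alpha c < +oo ->
  forall e : R, (0 < e)%R ->
  \forall mn \near filter_prod \oo \oo, seq_norm r%:E alpha (off_window c mn) <= e%:E.
Proof.
move=> r0 cr e e0.
have c2 : \sum_(1 <= j <oo) seq_rearrangement c j ^+ 2 < +oo.
  by apply: (seq_norm_lty_sq _ cr); rewrite lte_fin.
have rn0 : r != 0%R by rewrite gt_eqF.
have er0 : (0 < e `^ r)%R by rewrite powR_gt0.
pose u mn i := seq_term alpha (off_window c mn) i `^ r * (i%:R^-1)%:E.
suff : \forall mn \near filter_prod \oo \oo, \sum_(1 <= i <oo) u mn i <= (e `^ r)%:E.
  apply: filterS => mn h; apply: (@le_trans _ _ ((e `^ r)%:E `^ r^-1)).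
    apply: ge0_lee_poweR => //; first by rewrite invr_ge0 ltW.
    by apply: nneseries_ge0 => i _ _; rewrite mule_ge0 ?poweR_ge0// lee_fin invr_ge0.
  by rewrite poweR_EFin -powRrM divff// powRr1// ltW.
apply: (@dominated_series _ _ _ FF u (fun i => seq_term alpha c i `^ r * (i%:R^-1)%:E)) => //.
- by move=> mn i; rewrite mule_ge0 ?poweR_ge0// lee_fin invr_ge0.
- by move=> i; rewrite mule_ge0 ?poweR_ge0// lee_fin invr_ge0.
- move=> mn i; apply: lee_wpmul2r; first by rewrite lee_fin invr_ge0.
  apply: ge0_lee_poweR; [exact: ltW|exact: seq_term_ge0|].
  by apply: le_seq_term => n; exact: off_window_le.
- by apply: (@lty_poweRy _ _ r^-1) => //; exact: invr_neq0.
move=> i i1 d d0.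
have i0 : (0 < i%:R :> R)%R by rewrite ltr0n.
have w0 := log_weight_gt0 alpha (i%:R : R).
(* Solves (weight * y)^r / i = d, so a tail of l_2 norm at most y makes the i-th term at most d. *)
pose y := ((d * i%:R) `^ r^-1 / log_weight alpha (i%:R : R))%R.
have y0 : (0 < y)%R by rewrite divr_gt0// powR_gt0// mulr_gt0.
have y20 : (0 < y ^+ 2)%R by rewrite exprn_gt0.
have := off_window_sum_near c2 y20; apply: filterS => mn h.
have h' : seq_term alpha (off_window c mn) i <= ((d * i%:R) `^ r^-1)%:E.
  apply: (@le_trans _ _ ((log_weight alpha i%:R)%:E * y%:E)); last first.
    by rewrite -EFinM lee_fin mulrC divfK// gt_eqF.
  apply: lee_wpmul2l; first by rewrite lee_fin ltW.
  apply: (poweR_half_le _ _ (lexx _) (ltW y0)).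
    by apply: nneseries_ge0 => j _ _; rewrite expe_ge0// seq_rearrangement_ge0.
  exact: le_trans (tail_le_tail _ i1) h.
apply: (@le_trans _ _ (((d * i%:R) `^ r^-1)%:E `^ r * (i%:R^-1)%:E)).
  apply: lee_wpmul2r; first by rewrite lee_fin invr_ge0.
  apply: ge0_lee_poweR => //; [exact: ltW|exact: seq_term_ge0].
rewrite poweR_EFin -powRrM mulVf// powRr1; last by rewrite ltW// mulr_gt0.
by rewrite -EFinM lee_fin mulfK// gt_eqF.
Qed.

End off_window.

(** * Powers of 1 + ln M and the choice of J *)

Section constants.
Context {R : realType}.

(** From 1 + x <= e^x at x = ln M / (a + 1) one gets 1 + ln M <= (a + 1) M^(1/(a + 1)). Raising this
    to the power a + 1 leaves M itself; using a + 1 in place of a keeps a = 0 admissible. *)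
Lemma powR_log_le (a M : R) : 0 <= a -> 1 <= M ->
  (1 + ln M) `^ a <= (a + 1) `^ (a + 1) * M.
Proof.
move=> a0 M1; have M0 : 0 < M by exact: lt_le_trans M1.
have L0 : 0 <= ln M by exact: ln_ge0.
have a10 : 0 < a + 1 by rewrite ltr_wpDl.
apply: (@le_trans _ _ ((1 + ln M) `^ (a + 1))).
  by rewrite ler_powR ?lerDl.
have h : 1 + ln M <= (a + 1) * expR (ln M / (a + 1)).
  apply: (@le_trans _ _ ((a + 1) * (1 + ln M / (a + 1)))).
    rewrite mulrDr mulr1 mulrCA divff ?mulr1 ?gt_eqF//; lra.
  by rewrite ler_wpM2l ?(ltW a10)// expR_ge1Dx.
apply: (@le_trans _ _ (((a + 1) * expR (ln M / (a + 1))) `^ (a + 1))).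
  apply: ge0_ler_powR => //; first exact: ltW.
    by rewrite nnegrE addr_ge0.
  by rewrite nnegrE mulr_ge0 ?expR_ge0// ltW.
rewrite powRM ?expR_ge0 ?(ltW a10)// ler_wpM2l ?powR_ge0//.
by rewrite -expRM divfK ?gt_eqF// lnK.
Qed.

Lemma powR_log_le_min (a eps M : R) : 0 <= a -> 0 < eps -> 1 <= M ->
  (1 + ln M) `^ a <=
  (1 + (a + 1) `^ (a + 1)) * Num.min M ((1 + ln M) `^ (a + eps)).
Proof.
move=> a0 e0 M1; have L0 : 0 <= ln M by exact: ln_ge0.
have p0 : 0 <= (a + 1) `^ (a + 1) by exact: powR_ge0.
rewrite minEle; case: ifPn => _.
  apply: le_trans (powR_log_le a0 M1) _; rewrite ler_wpM2r ?lerDr//.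
  exact: le_trans M1.
apply: (@le_trans _ _ ((1 + ln M) `^ (a + eps))).
  by rewrite ler_powR ?lerDl// ltW.
by rewrite ler_peMl ?powR_ge0// lerDl.
Qed.

(** For lam = ln b the first inequality is M^2 <= b^J, and the second says that J can be kept of the
    order of 1 + ln M. *)
Lemma scale_exists (lam M : R) : 0 < lam -> 1 <= M ->
  exists2 J : nat, 2 * ln M <= J%:R * lam &
    1 + J%:R <= (2 + 2 / lam) * (1 + ln M).
Proof.
move=> l0 M1; have L0 : 0 <= ln M by exact: ln_ge0.
have y0 : 0 <= 2 * ln M / lam by rewrite divr_ge0 ?mulr_ge0// ltW.
have /andP[h1 h2] := truncn_itv y0.
exists (Num.truncn (2 * ln M / lam)).+1.
  by rewrite -ler_pdivrMr// ltW.
rewrite -natr1; move: h1; move: (Num.truncn _) => n; rewrite mulrAC => h1.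
have : 0 <= 2 / lam by rewrite divr_ge0// ltW.
by move: h1; lra.
Qed.

End constants.

Section uniform_bound.
Context {R : realType}.

(** One unit above the integer part to exceed |alpha|, and one more to gain the factor 1/2. *)
Definition ratio_exp (alpha : R) : nat := (Num.truncn `|alpha|).+2.

Lemma ratio_expP (alpha : R) : 2 `^ `|alpha| * 2 ^- ratio_exp alpha <= 1 / 2 :> R.
Proof.
have /andP[_ h] := truncn_itv (normr_ge0 alpha).
rewrite /ratio_exp exprSr invfM mulrA; apply: ler_pM => //.
rewrite ler_pdivrMr ?exprn_gt0// mul1r -powR_mulrn// ler_powR ?(ltW h)//.
by rewrite ler1n.
Qed.

(** The ratio b, and with it the constant, is fixed before the system is given; M enters only
    through J. At q = +oo the term [fine (q^-1)] is 0. *)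
Lemma uniform_bound (q : \bar R) (alpha : R) : (0 < q)%E ->
  exists2 C : R, 0 < C &
  forall (k : index_kind) (phi : index_type k -> R -> R[i]) (M : R),
  orthonormal_system phi ->
  ereal_sup [set Lnorm01 +oo%E (phi n) | n in [set: index_type k]] = M%:E ->
  forall c : index_type k -> R[i], (seq_norm q alpha c < +oo)%E ->
  forall f : R -> R[i], is_sum c phi f ->
  (fun_norm q alpha f <=
   (C * (1 + ln M) `^ (`|alpha| + fine (q^-1)%E))%:E * seq_norm q alpha c)%E.
Proof.
move=> q0.
pose p := ratio_exp alpha; have p1 : (1 <= p)%N by [].
have pa := ratio_expP alpha; rewrite -/p in pa.
pose b := (4 ^ p)%N; pose lam : R := ln b%:R; pose W := wratio lam `^ `|alpha|.
have b1 : 1 < b%:R :> R by rewrite ltr1n /b -{1}(expn0 4) ltn_exp2l.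
have b0 : 0 < b%:R :> R by exact: lt_trans b1.
have lam0 : 0 < lam by rewrite ln_gt0.
have W0 : 0 < W by rewrite powR_gt0// (lt_le_trans ltr01)// wratio_ge1.
have A0 : 0 < 2 `^ `|alpha| :> R by rewrite powR_gt0.
pose E : R := 2 + 2 / lam.
have E0 : 0 < E by rewrite addr_gt0// divr_gt0.
have scale M : 1 <= M -> exists2 J : nat, M ^+ 2 <= b%:R ^+ J &
    forall a, 0 <= a -> (1 + J%:R) `^ a <= E `^ a * (1 + ln M) `^ a.
  move=> M1; have M0 : 0 < M by exact: lt_le_trans M1.
  have L0 : 0 <= ln M by exact: ln_ge0.
  have [J h1 h2] := scale_exists lam0 M1; exists J.
    rewrite -ler_ln ?posrE ?exprn_gt0// !lnXn// -[X in X <= _]mulr_natl.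
    by rewrite -[X in _ <= X]mulr_natl.
  move=> a a0; rewrite -powRM ?(ltW E0) ?addr_ge0//.
  apply: ge0_ler_powR => //; first by rewrite nnegrE addr_ge0.
  by rewrite nnegrE mulr_ge0 ?(ltW E0)// addr_ge0.
case: q q0 => [r r0|oo0|//]; last first.
  exists (W * (4 * 2 `^ `|alpha| * 2 * E `^ `|alpha| * W)).
    by rewrite !mulr_gt0// powR_gt0.
  move=> k phi M phio phiM c cfin f fc.
  have M1 := system_bound_ge1 phio phiM.
  have c2 := seq_norm_lty_sq oo0 cfin.
  have [J MJ JE] := scale _ M1.
  have c0 : (0 <= seq_norm +oo alpha c)%E.
    apply: le_trans (seq_term_ge0 alpha c 1) _.
    by apply: ereal_sup_ubound; exists 1%N.
  have cE : seq_norm +oo alpha c = (fine (seq_norm +oo alpha c))%:E.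
    by rewrite fineK// ge0_fin_numE.
  have X0 : 0 <= fine (seq_norm +oo alpha c) by rewrite fine_ge0.
  have cX : (seq_norm +oo alpha c <= (fine (seq_norm +oo alpha c))%:E)%E by rewrite -cE.
  apply: (le_trans (fun_norm_sup_le p1 pa phio phiM fc c2 MJ cX)).
  rewrite [in leRHS]cE -EFinM lee_fin invey addr0.
  have := JE `|alpha| (normr_ge0 _).
  set X := fine _ in X0 *; set L := (1 + ln M) `^ _; set Q := (1 + J%:R) `^ _ => QL.
  rewrite -/b -/lam -/W.
  have -> : W * (4 * 2 `^ `|alpha| * 2 * Q * (W * X)) =
    (W * 4 * 2 `^ `|alpha| * 2 * W * X) * Q by ring.
  have -> : W * (4 * 2 `^ `|alpha| * 2 * E `^ `|alpha| * W) * L * X =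
    (W * 4 * 2 `^ `|alpha| * 2 * W * X) * (E `^ `|alpha| * L) by ring.
  apply: ler_wpM2l QL.
  by rewrite !mulr_ge0// ltW.
rewrite lte_fin in r0.
have rn0 : r != 0 by rewrite gt_eqF.
(* Collects the factors of [fun_norm_sum_le] that involve neither J nor the sequence. *)
pose D : R := b%:R * W `^ r *
  ((1 + (1 + 3 `^ r) / (1 - (3 / 4) `^ r)) * (2 * 2 `^ `|alpha|) `^ r * 2 `^ r) *
  (1 + 2 * (2 `^ `|alpha| * W) `^ r).
have D0 : 0 < D.
  have h1 : 0 < 1 + (1 + 3 `^ r) / (1 - (3 / 4) `^ r) :> R.
    apply: addr_gt0 => //; apply: divr_gt0.
      by rewrite addr_gt0// powR_gt0.
    by rewrite subr_gt0 powR_lt1//; lra.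
  have h2 : 0 < 1 + 2 * (2 `^ `|alpha| * W) `^ r.
    by rewrite addr_gt0// mulr_gt0// powR_gt0// mulr_gt0.
  rewrite /D; apply: mulr_gt0 => //; apply: mulr_gt0; first by rewrite mulr_gt0// powR_gt0.
  by rewrite !mulr_gt0// powR_gt0// mulr_gt0.
exists (D `^ r^-1 * E `^ (`|alpha| + r^-1)); first by rewrite mulr_gt0// powR_gt0.
move=> k phi M phio phiM c cfin f fc.
have M1 := system_bound_ge1 phio phiM.
have c2 := seq_norm_lty_sq (r0 : (0 < r%:E)%E) cfin.
have [J MJ JE] := scale _ M1.
set Sig := (\sum_(1 <= i <oo) (seq_term alpha c i `^ r * (i%:R^-1)%:E))%E.
have Sig0 : (0 <= Sig)%E.
  by apply: nneseries_ge0 => i _ _; rewrite mule_ge0 ?poweR_ge0// lee_fin invr_ge0.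
have SigE : Sig = (fine Sig)%:E.
  rewrite fineK// ge0_fin_numE//; apply: (@lty_poweRy _ _ r^-1) => //.
  exact: invr_neq0.
have Q0 : 0 <= fine Sig by rewrite fine_ge0.
have SigQ : (Sig <= (fine Sig)%:E)%E by rewrite -SigE.
apply: (le_trans (fun_norm_sum_le p1 pa phio phiM fc c2 MJ r0 SigQ)).
rewrite -/b -/lam -/W /seq_norm -/Sig [in leRHS]SigE poweR_EFin -EFinM lee_fin.
rewrite inver (negbTE rn0)/=.
move: Q0; set Q := fine Sig => Q0.
have J0 : 0 <= 1 + J%:R :> R by rewrite addr_ge0.
have -> : b%:R * W `^ r * ((1 + (1 + 3 `^ r) / (1 - (3 / 4) `^ r)) *
    (2 * 2 `^ `|alpha|) `^ r * (2 `^ r * (1 + J%:R) `^ `|alpha| `^ r * (1 + J%:R)) *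
    ((1 + 2 * (2 `^ `|alpha| * W) `^ r) * Q)) =
    D * ((1 + J%:R) `^ `|alpha| `^ r * (1 + J%:R)) * Q.
  have regroup (x1 x2 x3 x4 x5 x6 x7 x8 x9 : R) :
    x1 * x2 * (x3 * x4 * (x5 * x6 * x7) * (x8 * x9)) =
    x1 * x2 * (x3 * x4 * x5) * x8 * (x6 * x7) * x9 by ring.
  exact: regroup.
have h0 : 0 <= (1 + J%:R) `^ `|alpha| `^ r * (1 + J%:R) :> R.
  by rewrite mulr_ge0// powR_ge0.
rewrite powRM//; last by rewrite mulr_ge0// ltW.
rewrite ler_wpM2r ?powR_ge0// powRM ?(ltW D0)// -mulrA ler_wpM2l ?powR_ge0//.
(* The r-th root turns (1 + J)^(|alpha| r) (1 + J) into (1 + J)^(|alpha| + 1/r). *)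
rewrite powRM ?powR_ge0// -powRrM divff// powRr1 ?powR_ge0//.
rewrite -powRD; last by rewrite (gt_eqF (ltr_pwDl ltr01 (ler0n _ _))) implybT.
by apply: JE; rewrite addr_ge0// invr_ge0 ltW.
Qed.

End uniform_bound.

Theorem theorem1p2 (R : realType) (q : \bar R) (alpha eps : R)
  (hq : (0 < q)%E) (halpha : (- q^-1 < alpha%:E)%E) (heps : 0 < eps) :
  exists C : R, 0 < C /\
  forall (k : index_kind) (phi : index_type k -> R -> R[i]) (M : R),
  orthonormal_system phi ->
  ereal_sup [set Lnorm01 +oo%E (phi n) | n in [set: index_type k]] = M%:E ->
  forall c : index_type k -> R[i],
  (forall f : R -> R[i], is_sum c phi f ->
    (fun_norm q alpha f <=
      (C * Num.min M ((1 + ln M) `^ (`|alpha| + eps + fine (q^-1))))%:E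
      * seq_norm q alpha c)%E) /\
  ((seq_norm q alpha c < +oo)%E ->
    exists f : R -> R[i],
      [/\ is_sum c phi f,
          (fun_norm q alpha f < +oo)%E &
          ((q < +oo)%E -> series_cvg_to (fun_norm q alpha) c phi f)]).
Proof.
have [C0 C00 bound] := uniform_bound alpha hq.
pose a : R := `|alpha| + fine (q^-1)%E.
have a0 : 0 <= a.
  rewrite addr_ge0// fine_ge0//; case: (q) hq => [r|//|//].
  by rewrite lte_fin => r0; rewrite inver gt_eqF//= lee_fin invr_ge0 ltW.
pose C := C0 * (1 + (a + 1) `^ (a + 1)).
have C_gt0 : 0 < C by rewrite mulr_gt0// ltr_pwDl// powR_ge0.
exists C; split => // k phi M phio phiM c.
have M1 := system_bound_ge1 phio phiM.
have L0 : 0 <= ln M by exact: ln_ge0.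
have min0 : 0 < Num.min M ((1 + ln M) `^ (`|alpha| + eps + fine (q^-1)%E)).
  by rewrite lt_min (lt_le_trans ltr01 M1) powR_gt0// ltr_pwDl.
split.
  move=> f fc.
  (* With an infinite sequence norm the right-hand side is +oo, because the constant in front is
     positive. *)
  have [cfin|] := ltP (seq_norm q alpha c) +oo%E; last first.
    by rewrite leye_eq => /eqP ->; rewrite gt0_muley ?leey// lte_fin mulr_gt0.
  apply: (le_trans (bound _ _ _ phio phiM _ cfin _ fc)).
  apply: lee_wpmul2r.
    case: (q) => [r| |]//=; first exact: poweR_ge0.
    apply: le_trans (seq_term_ge0 alpha c 1) _.
    by apply: ereal_sup_ubound; exists 1%N.
  rewrite lee_fin /C -mulrA ler_wpM2l ?(ltW C00)// (addrAC _ eps).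
  exact: powR_log_le_min.
move=> cfin.
have c2 := seq_norm_lty_sq hq cfin.
have [f fc] := riesz_fischer phio c2; exists f; split => //.
  apply: le_lt_trans (bound _ _ _ phio phiM _ cfin _ fc) _.
  by rewrite lte_mul_pinfty// lee_fin mulr_ge0 ?powR_ge0// ltW.
(* Only finite q remains: a supremum has no small tails, so domination would give nothing at q =
   +oo. *)
move=> qfin; case: q hq qfin cfin bound {halpha a a0 C C_gt0 min0} => [r|//|//].
rewrite lte_fin => r0 _ cfin bound.
have bnd := bound _ _ _ phio phiM.
move: bnd; set B := C0 * _ => bnd.
have B0 : 0 <= B by rewrite mulr_ge0 ?powR_ge0// ltW.
have FF : Filter (filter_prod (\oo : set_system nat) (\oo : set_system nat)).
  exact: filter_prod_filter.
apply: (@cvge0 _ _ _ FF); first by move=> mn; exact: poweR_ge0.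
move=> e e0; have d0 : 0 < e / (B + 1) by rewrite divr_gt0// ltr_wpDl.
(* The system is now fixed, so [B], although it contains M, is one constant for all windows. *)
have := off_window_norm_near r0 cfin d0; apply: filterS => mn h.
have off_fin := le_lt_trans h (ltry _).
apply: (le_trans (bnd _ off_fin _ (is_sum_off_window phio mn fc))).
apply: (@le_trans _ _ (B%:E * (e / (B + 1))%:E)%E); first exact: lee_wpmul2l.
rewrite -EFinM lee_fin mulrCA ler_piMr ?(ltW e0)//.
by rewrite ler_pdivrMr ?ltr_wpDl// mul1r lerDl.
Qed.
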